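(* Let $n\ge 3$, let $R=\mathbb{Z}$ or $R=\mathbb{Z}_m$ with $m\geq 2$, and let $G_n=\mathrm{GL}(n,R)$. Let $H$ be a subgroup of $G_n$ of level $l\ge 1$ (that is, of non-zero level), with maximal principal congruence subgroup $\Gamma_{n,r}$. Then $H$ is subnormal in $G_n$ if and only if $r\mid l^e$ for some non-negative integer $e$. In that event, the defect of $H$ is bounded above by $e'+1$, where $e'$ is the least such $e$.
   Context: $\mathbb{Z}_m=\mathbb{Z}/m\mathbb{Z}$. For an ideal $I$ of $R$, $\Gamma_{n,I}$ denotes the kernel of the natural map $\mathrm{SL}(n,R)\to\mathrm{SL}(n,R/I)$, called the principal congruence subgroup (PCS) of level $I$ of $\Gamma_n=\mathrm{SL}(n,R)$; if $I=rR$ one writes $\Gamma_{n,r}$ and says the level is $r$ (the ideals $I=R$ and $I=0$ are allowed, so $\Gamma_{n,1}=\Gamma_n$ and $\Gamma_{n,0}$ is trivial). The maximal PCS in $H$ is the PCS of $\Gamma_n$ contained in $H$ that contains every PCS of $\Gamma_n$ contained in $H$. The level $\ell(h)$ of $h=(h_{ij})\in G_n$ is the ideal of $R$ generated by all $h_{ij}$ with $i\ne j$ and all $h_{ii}-h_{jj}$ ($1\le i,j\le n$), and the level of a subset $A\subseteq G_n$ is $\ell(A)=\sum_{a\in A}\ell(a)$; as $R$ is a principal ideal ring, a level is identified with a generator of the ideal (a non-negative integer if $R=\mathbb{Z}$, an integer modulo $m$ if $R=\mathbb{Z}_m$, which can be taken to be a divisor of $m$). Divisibility $r\mid l^e$ is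 in $R$, i.e. $l^eR\subseteq rR$. The defect of a subnormal subgroup $H$ of $G_n$ is the least $d$ such that there is a series $H=H_0\unlhd H_1\unlhd\cdots\unlhd H_d=G_n$. *)

(* Defs.v *)
From mathcomp Require Import all_boot all_order all_algebra.
From mathcomp Require Import boolp classical_sets.

Set Implicit Arguments.
Unset Strict Implicit.
Unset Printing Implicit Defensive.

Import GRing.Theory.

Local Open Scope classical_set_scope.
Local Open Scope ring_scope.

(* The bound 1 < m matters: 'Z_0 and 'Z_1 are by construction the ring Z/2Z. *)
Inductive Z_or_Zm : comUnitRingType -> Prop :=
  | Z_or_Zm_int : Z_or_Zm int
  | Z_or_Zm_mod (m : nat) : (1 < m)%N -> Z_or_Zm 'Z_m.

Section Ideals.
Variable R : comUnitRingType.

Definition is_ideal (I : set R) : Prop :=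
  [/\ I 0, forall x y, I x -> I y -> I (x + y) & forall a x, I x -> I (a * x)].

Definition principal (r : R) : set R := [set x | exists a, x = a * r].

Definition divides (r s : R) : Prop := principal s `<=` principal r.

End Ideals.

Section LinearGroups.
Variables (R : comUnitRingType) (n : nat).
Implicit Types (A H K P : set 'M[R]_n) (I : set R) (d : nat).

Definition GL : set 'M[R]_n := [set g | g \in unitmx].

Definition is_subgroup H : Prop :=
  [/\ H `<=` GL, H 1%:M, forall g h, H g -> H h -> H (g *m h)
    & forall g, H g -> H (invmx g)].

Definition is_normal_in H K : Prop :=
  [/\ is_subgroup H, is_subgroup K, H `<=` K
    & forall g h, K g -> H h -> H (invmx g *m h *m g)].

(* The kernel of SL(n,R) -> SL(n,R/I), written as an entrywise congruence so
   that I may be the whole ring (MathComp quotient rings are non-trivial). *)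
Definition pcs I : set 'M[R]_n :=
  [set g | \det g = 1 /\ forall i j, I (g i j - 1%:M i j)].

Definition is_pcs P : Prop := exists2 I, is_ideal I & P = pcs I.

Definition is_max_pcs H P : Prop :=
  [/\ is_pcs P, P `<=` H & forall Q, is_pcs Q -> Q `<=` H -> Q `<=` P].

Definition mx_level (h : 'M[R]_n) : set R :=
  smallest (@is_ideal R)
    ([set x | exists i j, i != j /\ x = h i j] `|`
     [set x | exists i j, x = h i i - h j j]).

(* The sum of a family of ideals is the ideal generated by their union. *)
Definition level A : set R :=
  smallest (@is_ideal R) (\bigcup_(a in A) mx_level a).

Definition subnormal_series H d : Prop :=
  exists S : nat -> set 'M[R]_n,
    [/\ S 0%N = H, S d = GL
      & forall i, (i < d)%N -> is_normal_in (S i) (S i.+1)].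

Definition is_subnormal H : Prop := exists d, subnormal_series H d.

End LinearGroups.

Definition is_least (P : nat -> Prop) (k : nat) : Prop :=
  P k /\ forall j, P j -> (k <= j)%N.

Definition is_defect (R : comUnitRingType) (n : nat) (H : set 'M[R]_n)
    (d : nat) : Prop :=
  is_least (subnormal_series H) d.

(* Main.v *)
Require Import Defs.
From HB Require Import structures.
From mathcomp Require Import all_boot all_order all_algebra all_fingroup all_solvable.
From mathcomp Require Import generic_quotient boolp classical_sets.
From mathcomp Require Import ring zify.

Set Implicit Arguments.
Unset Strict Implicit.
Unset Printing Implicit Defensive.

Import GRing.Theory Num.Theory.

Local Open Scope ring_scope.

(** If [H] has level [l], its elements are scalar modulo [l], so commutators of
    [H] with [Gamma_(l^k)] lie in [Gamma_(l^(k+1))]; the groups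
    [H * Gamma_(l^(e-j))], followed by [GL], form a series of length [e+1] as
    soon as [Gamma_(l^e)] is contained in [H].

    Conversely, call [z] good for [K] if, for some [k], [K] contains all
    elementary matrices with entries in [z^k R].  If [H] is normal in [K] and
    [z] is good for [K], then [z * h_ij] ([i <> j]) and [z * (h_ii - h_jj)] are
    good for [H], for every [h] in [H]; good elements form a radical ideal.  As
    [1] is good for [GL], descending a normal series shows that [l] is good for
    [H].  By Suslin's argument [H] then contains all [GL]-conjugates of the
    elementary matrices of some level [q = l^(2k)], and these generate
    [Gamma_q] (the congruence subgroup property for [Z] and [Z_m], [n >= 3]).
    For the latter, modulo the normal closure [E(q)] an element of [Gamma_q] is
    reduced to a 2 x 2 block, which the Euclidean algorithm writes as a word in
    [x_12] and [x_21].  The Steinberg relations hold in [SL_n / E(q)] and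
    [x_ij(Q) = 1] there, with [Q] generating the preimage of [q R] in [Z].  An
    idempotent modulo [Q] splits the word into words over the local rings
    [Z / p^k], where words have a normal form because all Steinberg symbols
    vanish. *)

(** * Steinberg relations and symbols *)

(** The obstacle is a 2 x 2 block congruent to 1 modulo q: inside rank two nothing guarantees that
    level-q operations reduce it, so it is written as an unrestricted word and that word is killed
    in the quotient group. The Steinberg relations alone do not suffice for this. For p = 2 the
    symbol {-1, -1}, which is a fourth power of a Weyl element, need not be trivial as a consequence
    of them, already modulo 4. The relation w^4 = 1, true for matrices, is therefore carried as an
    extra hypothesis. It is consumed only by the 2-part, which is why the odd prime powers are split
    off first. The bound n >= 3 acts through one device, used again and again: no relation links
    x_ij to x_ji directly, but x_ij(t) is the commutator of x_ik(t) and x_kj(1) for a third index k,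
    and these two factors are accessible. For the congruence subgroup property, Z and Z_m enter only
    as rings covered by Z, with division with remainder, and with a positive integer Q standing for
    the ideal q R. The possible zero divisors of Z_m thus need no separate treatment. *)

Lemma commMr_central (G : groupType) (s a b c : G) :
  commute s a -> commute s b -> commute s c -> commute (a * c * a^-1 * c^-1)%g b ->
  (a * (s^-1 * (b * c)) * a^-1 * (s^-1 * (b * c))^-1 =
   a * b * a^-1 * b^-1 * (a * c * a^-1 * c^-1))%g.
Proof.
move=> sa sb sc cb; have sbc := commuteM sb sc.
have sX : commute (a * (b * c) * a^-1 * (b * c)^-1)%g s.
  apply/commute_sym/commuteM; last exact: commuteV.
  by apply: commuteM; [apply: commuteM|apply: commuteV].
have as1 : commute a s^-1%g by apply: commuteV.
have -> : (a * (s^-1 * (b * c)) * a^-1 * (s^-1 * (b * c))^-1 =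
           (a * (b * c) * a^-1 * (b * c)^-1) ^ s)%g.
  by rewrite conjgE [in LHS]invgM invgK !mulgA as1.
have /commgP/conjg_fixP -> := sX.
have bd : commute (b^-1)%g (a * c * a^-1 * c^-1)%g by apply/commute_sym/commuteV.
rewrite -[in RHS]mulgA bd invgM !mulgA; congr (_ * _ * _ * _)%g.
by rewrite mulgVK.
Qed.

Definition wordg (G : groupType) (A : Type) (X Y : A -> G) (s : seq (bool * A)) : G :=
  foldl (fun g p => (g * (if p.1 then X p.2 else Y p.2))%g) 1%g s.

(* The quadruple (a, b, c, d) stands for the matrix [[a, b], [c, d]], and the
   letters (true, t), (false, t) for right multiplication by x_12(t), x_21(t). *)
Definition mstep (A : comUnitRingType) (M : A * A * A * A) (p : bool * A) :=
  let: (a, b, c, d) := M in let: (e, t) := p in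
  if e then (a, b + a * t, c, d + c * t) else (a + b * t, b, c + d * t, d).

Definition wordm (A : comUnitRingType) := foldl (@mstep A) (1, 0, 0, 1).

Section Steinberg.
Variables (G : groupType) (A : comUnitRingType) (I : eqType).

(** [stR] is the usual commutator relation with the inverses cleared, so that it rewrites products
    directly. Nothing is imposed on a pair of opposite roots (i, j), (j, i). *)
Record steinberg (x : I -> I -> A -> G) : Prop := Steinberg {
  stD : forall i j a b, i != j -> x i j (a + b) = (x i j a * x i j b)%g;
  stR : forall i j k a b, i != j -> j != k -> i != k ->
    (x i j a * x j k b = x j k b * x i j a * x i k (a * b)%R)%g;
  stC : forall i j k l a b, i != j -> k != l -> i != l -> j != k ->
    commute (x i j a) (x k l b) }.

Variable x : I -> I -> A -> G.
Hypothesis xP : steinberg x.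

Ltac neq := solve [assumption | by rewrite eq_sym | by []].

Lemma st0 i j : i != j -> x i j 0 = 1%g.
Proof.
by move=> ij; apply: (mulgI (x i j 0)); rewrite -(stD xP) // addr0 mulg1.
Qed.

Lemma stN i j a : i != j -> x i j (- a) = ((x i j a)^-1)%g.
Proof.
by move=> ij; apply/esym/mulg1_eq; rewrite -(stD xP) // subrr st0.
Qed.

Lemma st_conjr i j k a b : i != j -> j != k -> i != k ->
  (x j k b ^ x i j a = x j k b * x i k (- (a * b))%R)%g.
Proof.
move=> ij jk ik; rewrite conjgE.
have E := stR xP (- a) b ij jk ik; rewrite mulNr stN // in E.
rewrite mulgA E -mulgA (_ : _ * x i j a = x i j a * x i k (- (a * b))%R)%g; last first.
  by apply: (stC xP) => //; rewrite eq_sym.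
by rewrite mulgA mulgVK.
Qed.

Lemma st_conjl i j k a b : i != j -> k != j -> k != i ->
  (x k i b ^ x i j a = x k i b * x k j (a * b)%R)%g.
Proof.
by move=> ij kj ki; rewrite conjgE (stR xP) // (mulrC b) -?mulgA mulKg.
Qed.

Lemma st_conjC i j k l a b : i != j -> k != l -> i != l -> j != k ->
  (x k l b ^ x i j a = x k l b)%g.
Proof. by move=> ij kl il jk; apply/conjg_fixP/commgP/commute_sym/(stC xP). Qed.

Lemma st_comm i j k a b : i != j -> j != k -> i != k ->
  ([~ x i k a, x k j b] = x i j (a * b)%R)%g.
Proof.
by move=> ij jk ik; rewrite commgEl st_conjl //; try neq; rewrite mulKg mulrC.
Qed.

(** In rows and columns i, j the corresponding matrices are the Weyl element [[0, u], [-u^-1, 0]]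
    and, for [sth], diag(u, u^-1). Locking keeps rewriting from looking inside. *)
Definition stw i j u := locked (x i j u * x j i (- u^-1)%R * x i j u)%g.
Definition sth i j u := locked (stw i j u * stw i j (- 1)%R)%g.
Lemma stwE i j u : stw i j u = (x i j u * x j i (- u^-1)%R * x i j u)%g.
Proof. by rewrite /stw -lock. Qed.
Lemma sthE i j u : sth i j u = (stw i j u * stw i j (- 1)%R)%g.
Proof. by rewrite /sth -lock. Qed.
Local Notation w := stw.
Local Notation h := sth.
Local Notation unit := (GRing.unit : {pred A}).

Lemma stwV i j u : i != j -> ((w i j u)^-1 = w i j (- u)%R)%g.
Proof.
move=> ij; have ji : j != i by neq.
by rewrite !stwE !invgM -!stN // opprK invrN opprK mulgA.
Qed.

Lemma conj_w_ik i j k u t : i != j -> j != k -> i != k -> u \in unit ->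
  (x i k t ^ w i j u = x j k (u^-1 * t)%R)%g.
Proof.
move=> ij jk ik Uu; have [ji kj ki] : [/\ j != i, k != j & k != i] by split; neq.
rewrite !stwE !conjgM st_conjC // st_conjr // conjMg st_conjC // st_conjr //.
rewrite mulNr opprK mulrA mulrV // mul1r stN //.
by rewrite mulgA (stC xP) // mulgK.
Qed.

Lemma conj_w_jk i j k u t : i != j -> j != k -> i != k -> u \in unit ->
  (x j k t ^ w i j u = x i k (- (u * t))%R)%g.
Proof.
move=> ij jk ik Uu; have [ji kj ki] : [/\ j != i, k != j & k != i] by split; neq.
rewrite !stwE !conjgM st_conjr // conjMg st_conjC // st_conjr //.
rewrite (_ : - (- u^-1 * - (u * t)) = - t); last by rewrite mulrNN mulrA mulVr // mul1r.
by rewrite mulgA (stC xP) // -mulgA -(stD xP) // subrr st0 // mulg1 st_conjC.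
Qed.

Lemma conj_w_ki i j k u t : i != j -> j != k -> i != k -> u \in unit ->
  (x k i t ^ w i j u = x k j (u * t)%R)%g.
Proof.
move=> ij jk ik Uu; have [ji kj ki] : [/\ j != i, k != j & k != i] by split; neq.
rewrite !stwE !conjgM st_conjl // conjMg st_conjC // st_conjl //.
rewrite (_ : - u^-1 * (u * t) = - t); last by rewrite mulNr mulrA mulVr // mul1r.
by rewrite mulgA (stC xP) // -mulgA -(stD xP) // subrr st0 // mulg1 st_conjC.
Qed.

Lemma conj_w_kj i j k u t : i != j -> j != k -> i != k -> u \in unit ->
  (x k j t ^ w i j u = x k i (- (u^-1 * t))%R)%g.
Proof.
move=> ij jk ik Uu; have [ji kj ki] : [/\ j != i, k != j & k != i] by split; neq.
rewrite !stwE !conjgM st_conjC // st_conjl // conjMg st_conjC // st_conjl //.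
rewrite (_ : u * (- u^-1 * t) = - t); last by rewrite mulNr mulrN mulrA mulrV // mul1r.
by rewrite mulgA (stC xP) // -mulgA -(stD xP) // subrr st0 // mulg1 mulNr.
Qed.

(** Direct expansion would need a relation between opposite roots. Instead x_ij(t) is written as the
    commutator of x_ik(t) and x_kj(1), whose conjugates are known from [conj_w_ik] and
    [conj_w_kj]. *)
Lemma conj_w_ij i j k u t : i != j -> j != k -> i != k -> u \in unit ->
  (x i j t ^ w i j u = x j i (- (u^-1 * (u^-1 * t)))%R)%g.
Proof.
move=> ij jk ik Uu; have [ji kj ki] : [/\ j != i, k != j & k != i] by split; neq.
rewrite -[t]mulr1 -(st_comm _ _ ij jk ik) conjRg conj_w_ik // conj_w_kj //.
by rewrite st_comm //; congr (x _ _ _); ring.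
Qed.

Lemma conj_w_ji i j k u t : i != j -> j != k -> i != k -> u \in unit ->
  (x j i t ^ w i j u = x i j (- (u * (u * t)))%R)%g.
Proof.
move=> ij jk ik Uu; have [ji kj ki] : [/\ j != i, k != j & k != i] by split; neq.
rewrite -[t]mulr1 -(st_comm _ _ ji ik jk) conjRg conj_w_jk // conj_w_ki //.
by rewrite st_comm //; congr (x _ _ _); ring.
Qed.

Lemma conj_w_off i j a b u t : i != j -> a != b -> a != i -> a != j ->
  b != i -> b != j -> (x a b t ^ w i j u = x a b t)%g.
Proof.
move=> ij ab ai aj bi bj; have ji : j != i by neq.
by rewrite !stwE !conjgM !st_conjC //; neq.
Qed.

Hypothesis third : forall i j : I, i != j -> exists2 k, j != k & i != k.

Definition hd i j u (l : I) : A := if l == i then u else if l == j then u^-1 else 1.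

(** The effect of conjugation by diag(d); [hd i j u] is the diagonal of the matrix of [sth i j u].
    Equality of actions is what makes symbols central. *)
Definition acts g (d : I -> A) :=
  forall a b t, a != b -> (x a b t ^ g = x a b ((d a)^-1 * d b * t)%R)%g.

Lemma acts_h i j u : i != j -> u \in unit -> acts (h i j u) (hd i j u).
Proof.
move=> ij Uu a b t ab; have [k jk ik] := third ij.
have ji : j != i by neq.
have U1 : (-1 : A) \in unit by rewrite unitrN1.
rewrite !sthE conjgM /hd; case: (eqVneq a i) => [ai|ai].
  subst a; rewrite eq_sym (negPf ab); case: (eqVneq b j) => [->|bj].
    rewrite (conj_w_ij _ ij jk ik) // (conj_w_ji _ ij jk ik) //.
    by congr (x _ _ _); ring.
  rewrite conj_w_ik //; try neq; rewrite conj_w_jk //; try neq.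
  by congr (x _ _ _); ring.
case: (eqVneq a j) => [aj|aj].
  subst a; rewrite (eq_sym b j) (negPf ab) invrK; case: (eqVneq b i) => [->|bi].
    rewrite (conj_w_ji _ ij jk ik) // (conj_w_ij _ ij jk ik) //.
    by rewrite invrN1; congr (x _ _ _); ring.
  rewrite conj_w_jk //; try neq; rewrite conj_w_ik //; try neq.
  by rewrite invrN1; congr (x _ _ _); ring.
rewrite invr1; case: (eqVneq b i) => [bi|bi].
  subst b; rewrite conj_w_ki //; try neq; rewrite conj_w_kj //; try neq.
  by rewrite invrN1; congr (x _ _ _); ring.
case: (eqVneq b j) => [bj|bj].
  subst b; rewrite conj_w_kj //; try neq; rewrite conj_w_ki //; try neq.
  by congr (x _ _ _); ring.
by rewrite !conj_w_off // !mul1r.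
Qed.

Lemma actsM g1 g2 d1 d2 : (forall l, d1 l \in unit) -> (forall l, d2 l \in unit) ->
  acts g1 d1 -> acts g2 d2 -> acts (g1 * g2)%g (fun l => d1 l * d2 l).
Proof.
move=> U1 U2 A1 A2 a b t ab; rewrite conjgM A1 // A2 // invrM //.
by congr (x _ _ _); ring.
Qed.

Lemma actsV g d : (forall l, d l \in unit) -> acts g d -> acts (g^-1)%g (fun l => (d l)^-1).
Proof.
move=> U Ag a b t ab; apply: (conjg_inj g); rewrite conjgKV Ag // invrK.
congr (x _ _ _); have Ea := mulVr (U a); have Eb := mulVr (U b).
by ring: Ea Eb.
Qed.

Lemma hd_unit i j u l : u \in unit -> hd i j u l \in unit.
Proof. by rewrite /hd; case: ifP => // _; case: ifP => _; rewrite ?unitrV ?unitr1. Qed.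

Definition stcent g := forall a b t, a != b -> commute g (x a b t).

Lemma acts1_cent g d : acts g d -> d =1 (fun=> 1) -> stcent g.
Proof.
move=> Ag d1 a b t ab; apply/commute_sym/commgP/conjg_fixP.
by rewrite Ag // !d1 invr1 !mul1r.
Qed.

Lemma stcent_w g i j u : i != j -> stcent g -> commute g (w i j u).
Proof.
move=> ij cg; have ji : j != i by neq.
by rewrite stwE; exact: commuteM (commuteM (cg _ _ _ ij) (cg _ _ _ ji)) (cg _ _ _ ij).
Qed.

Lemma stcent_h g i j u : i != j -> stcent g -> commute g (h i j u).
Proof. by move=> ij cg; rewrite sthE; exact: commuteM (stcent_w _ ij cg) (stcent_w _ ij cg). Qed.

Lemma conj_w_h i j k u v : i != j -> j != k -> i != k -> u \in unit -> v \in unit ->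
  (w i j (u * v)%R ^ h i k u = w i j v)%g.
Proof.
move=> ij jk ik Uu Uv; have [ji kj ki] : [/\ j != i, k != j & k != i] by split; neq.
rewrite !stwE !conjMg !acts_h // /hd !eqxx (negPf ji) (negPf jk) !mulr1 invr1 mul1r.
by rewrite !invrM // mulKr // mulrN mulrCA mulrV ?mulr1.
Qed.

Lemma hV i j u : i != j -> ((h i j u)^-1 = (w i j (- 1)%R)^-1 * w i j (- u)%R)%g.
Proof. by move=> ij; rewrite !sthE invgM [(w i j u)^-1%g]stwV. Qed.

(** The product of [h i j (u * v)] with the inverse of [h i j u] is w_ij(uv) w_ij(-u). Conjugation
    by [h i k u] divides both arguments by u and leaves w_ij(v) w_ij(-1), which is [h i j v]. *)
Lemma conj_h i j k u v : i != j -> j != k -> i != k -> u \in unit -> v \in unit ->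
  (h i k u * h i j v = h i j (u * v)%R * (h i j u)^-1 * h i k u)%g.
Proof.
move=> ij jk ik Uu Uv.
have Uv' : v^-1 \in unit by rewrite unitrV.
have U1 : (-1 : A) \in unit by rewrite unitrN1.
have -> : (h i j (u * v)%R * (h i j u)^-1 = w i j (u * v)%R * w i j (u * -1)%R)%g.
  by rewrite hV // {1}sthE mulgA mulgK mulrN1.
apply: (mulgI ((h i k u)^-1)%g); rewrite mulKg -conjgE conjMg.
by rewrite !conj_w_h -?sthE.
Qed.

(** Since w_ij(u) conjugates x_ij(u) to x_ji(-u^-1), the left outer factor of w_ij(u) can be carried
    across it, where it becomes an outer factor of w_ji(-u^-1). *)
Lemma w_sym i j u : i != j -> u \in unit -> w i j u = w j i (- u^-1).
Proof.
move=> ij Uu; have [k jk ik] := third ij.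
have /(congr1 (fun g => w i j u * g)%g) := conj_w_ij u ij jk ik Uu.
rewrite conjgE mulVKg mulVr // mulr1 !stwE invrN invrK opprK => E.
by apply: (mulgI (x i j u)); rewrite -[RHS]mulgA in E *; rewrite E !mulgA.
Qed.

(** * Steinberg symbols and their identities *)

Section Symbol.
Variables (i j k : I).
Hypotheses (ij : i != j) (jk : j != k) (ik : i != k).
Let ji : j != i. Proof. by neq. Qed.
Let kj : k != j. Proof. by neq. Qed.
Let ki : k != i. Proof. by neq. Qed.
Local Notation H := (h i j).
Local Notation K := (h i k).

(* By [symb_cent] and the following lemmas this is the Steinberg symbol {u, v}:
   central, bimultiplicative, and trivial for u + v = 1. *)
Definition symb u v := locked (H u * H v * (H (u * v)%R)^-1)%g.
Lemma symb_def u v : symb u v = (H u * H v * (H (u * v)%R)^-1)%g.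
Proof. by rewrite /symb -lock. Qed.

Lemma symb_cent u v : u \in unit -> v \in unit -> stcent (symb u v).
Proof.
move=> Uu Uv; have Uuv : u * v \in unit by rewrite unitrM Uu.
have U t : t \in unit -> forall l, hd i j t l \in unit by move=> ? ?; apply: hd_unit.
have UM l : hd i j u l * hd i j v l \in unit by rewrite unitrM !U.
have UV l : (hd i j (u * v) l)^-1 \in unit by rewrite unitrV U.
rewrite symb_def; apply: acts1_cent (actsM UM UV (actsM (U _ Uu) (U _ Uv) (acts_h ij Uu) (acts_h ij Uv))
  (actsV (U _ Uuv) (acts_h ij Uuv))) _.
move=> l; rewrite /hd; case: ifP => _; first by rewrite divrr.
case: ifP => _; last by rewrite invr1 !mul1r.
by rewrite invrK -invrM // [v * u]mulrC mulVr.
Qed.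

Lemma conj_w_HK u : (H u ^ w j k 1 = K u)%g.
Proof.
have wK t : (w i j t ^ w j k 1 = w i k t)%g.
  have U1 := unitr1 A; rewrite (stwE i j) (stwE i k) !conjMg.
  by rewrite !(conj_w_ki _ jk ki ji) // !(conj_w_ik _ jk ki ji) // invr1 !mul1r.
by rewrite !sthE conjMg !wK.
Qed.

(** A central element is fixed by conjugation with [w j k 1], and this conjugation carries [H] to
    [K]. *)
Lemma symbK u v : u \in unit -> v \in unit ->
  symb u v = (K u * K v * (K (u * v)%R)^-1)%g.
Proof.
move=> Uu Uv; have /conjg_fixP <- : ([~ symb u v, w j k 1] == 1)%g.
  by apply/commgP; apply: stcent_w => //; apply: symb_cent.
by rewrite symb_def (conjMg (H u * H v)%g) (conjMg (H u)) conjVg !conj_w_HK.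
Qed.

(** The symbol as a commutator of two diagonal elements. Bimultiplicativity and antisymmetry both
    come from this form. *)
Lemma symb_conj u v : u \in unit -> v \in unit ->
  (K u * H v * (K u)^-1 * (H v)^-1)%g = symb u v.
Proof.
move=> Uu Uv; rewrite symbK //.
have := conj_h ik kj ij Uv Uu => E.
rewrite -!mulgA; congr (_ * _)%g; rewrite !mulgA.
apply: (mulIg (H v)); rewrite mulgVK; apply: (mulIg (K u)); rewrite mulgVK.
rewrite -(mulgA _ (H v) (K u)) E !mulgA [v * u]mulrC mulgVK.
by rewrite mulgV mul1g.
Qed.

Lemma symbV u v : u \in unit -> v \in unit ->
  symb u v = (H (u * v)%R * (H u)^-1 * (H v)^-1)%g.
Proof.
by move=> Uu Uv; rewrite -symb_conj // (conj_h ij jk ik Uu Uv) mulgK.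
Qed.

Lemma symb_anti u v : u \in unit -> v \in unit -> symb v u = ((symb u v)^-1)%g.
Proof.
by move=> Uu Uv; rewrite symbV // symb_def !invgM invgK mulrC mulgA.
Qed.

(** [H (v1 * v2)] differs from [H v1 * H v2] by a central symbol, and a commutator with [K u] that
    takes central values is multiplicative in its second argument. *)
Lemma symbMr u v1 v2 : u \in unit -> v1 \in unit -> v2 \in unit ->
  symb u (v1 * v2) = (symb u v1 * symb u v2)%g.
Proof.
move=> Uu U1 U2; have U12 : v1 * v2 \in unit by rewrite unitrM U1.
have HE : H (v1 * v2) = ((symb v1 v2)^-1 * (H v1 * H v2))%g.
  by rewrite symb_def !invgM invgK !mulgA !mulgVK.
rewrite -[LHS]symb_conj // HE commMr_central ?symb_conj //.
- by apply: stcent_h => //; apply: symb_cent.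
- by apply: stcent_h => //; apply: symb_cent.
- by apply: stcent_h => //; apply: symb_cent.
- by apply: stcent_h => //; apply: symb_cent.
Qed.

Lemma symbC u v u' v' : u \in unit -> v \in unit -> u' \in unit -> v' \in unit ->
  commute (symb u v) (symb u' v').
Proof.
move=> Uu Uv Uu' Uv'; have cs := symb_cent Uu Uv.
by rewrite (symb_def u' v'); apply: commuteM; [apply: commuteM|apply: commuteV]; apply: stcent_h.
Qed.

Lemma symbMl u1 u2 v : u1 \in unit -> u2 \in unit -> v \in unit ->
  symb (u1 * u2) v = (symb u1 v * symb u2 v)%g.
Proof.
move=> U1 U2 Uv; have U12 : u1 * u2 \in unit by rewrite unitrM U1.
rewrite symb_anti // symbMr // invgM -!symb_anti //.
exact: symbC.
Qed.

(** The claim reduces to w(u) w(-1) w(v) = w(uv). Written as w_ji(1), the middle factor has two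
    outer letters x_ji(1), which pass through w(u) and w(v) and become x_ij letters; the letters
    left in the centre add up to x_ij(u - 1 + v) = 1. *)
Lemma symb_steinberg u v : u \in unit -> v \in unit -> u + v = 1 -> symb u v = 1%g.
Proof.
move=> Uu Uv uv1; rewrite symb_def.
have U1 : (-1 : A) \in unit by rewrite unitrN1.
have Uuv : u * v \in unit by rewrite unitrM Uu.
suff E : (w i j u * w i j (-1)%R * w i j v = w i j (u * v)%R)%g.
  by rewrite !sthE !mulgA E mulgV.
rewrite [w i j (-1)]w_sym // invrN1 opprK (stwE j i) invr1.
have wy t z : z \in unit -> (w i j z * x j i t = x i j (- (z * (z * t)))%R * w i j z)%g.
  by move=> Uz; rewrite conjgCV stwV // (conj_w_ji t ij jk ik) ?unitrN //; congr (x _ _ _ * _)%g; ring.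
have yw t z : z \in unit -> (x j i t * w i j z = w i j z * x i j (- (z * (z * t)))%R)%g.
  by move=> Uz; rewrite conjgC (conj_w_ji t ij jk ik).
rewrite !mulgA wy // -(mulgA _ _ (w i j v)) yw //.
rewrite !mulr1 mulgA !stwE !mulgA -(stD xP) // -!mulgA -(stD xP) // !mulgA.
have E : u + -1 + v = 0 by rewrite addrAC uv1 subrr.
rewrite -(mulgA _ (x i j u) (x i j (-1))) -(stD xP) // -(mulgA _ _ (x i j v)) -(stD xP) //.
rewrite E st0 // mulg1 -(mulgA _ (x j i _) (x j i _)) -(stD xP) //.
have E1 := mulVr Uu; have E2 := mulVr Uv.
congr (x _ _ _ * x _ _ _ * x _ _ _)%g.
- have -> : v = 1 - u by rewrite -uv1 addrC addKr.
  by ring.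
- rewrite invrM //. have -> : v^-1 * u^-1 = (u + v) * (v^-1 * u^-1) by rewrite uv1 mul1r.
  by ring: E1 E2.
- have -> : u = 1 - v by rewrite -uv1 addrK.
  by ring.
Qed.

Lemma symb1l v : v \in unit -> symb 1 v = 1%g.
Proof.
by move=> Uv; apply: (mulgI (symb 1 v)); rewrite -symbMl ?unitr1 // mulr1 mulg1.
Qed.

Lemma symb1r u : u \in unit -> symb u 1 = 1%g.
Proof.
by move=> Uu; apply: (mulgI (symb u 1)); rewrite -symbMr ?unitr1 // mulr1 mulg1.
Qed.

Lemma symbE u v : u \in unit -> v \in unit -> (H u * H v = symb u v * H (u * v)%R)%g.
Proof. by move=> Uu Uv; rewrite symb_def mulgVK. Qed.

Lemma h1 : H 1 = 1%g.
Proof. by rewrite sthE -(stwV _ ij) mulgV. Qed.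

Local Notation X := (x i j).
Local Notation Y := (x j i).
Let XD a b : X (a + b) = (X a * X b)%g. Proof. exact: (stD xP). Qed.
Let YD a b : Y (a + b) = (Y a * Y b)%g. Proof. exact: (stD xP). Qed.

Lemma hX u t : u \in unit -> (H u * X t = X (u * (u * t)) * H u)%g.
Proof.
move=> Uu; rewrite [RHS]conjgC acts_h // /hd eqxx (negPf ji) eqxx.
by have E := mulVr Uu; congr (_ * X _)%g; ring: E.
Qed.

Lemma hY u t : u \in unit -> (Y t * H u = H u * Y (u * (u * t)))%g.
Proof.
move=> Uu; rewrite conjgC acts_h // /hd eqxx (negPf ji) eqxx invrK.
by congr (_ * Y _)%g; ring.
Qed.

Lemma wX z t : z \in unit -> (X t * w i j z = w i j z * Y (- (z^-1 * (z^-1 * t))))%g.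
Proof. by move=> Uz; rewrite conjgC (conj_w_ij t ij jk ik). Qed.

Lemma wY z t : z \in unit -> (w i j z * Y t = X (- (z * (z * t))) * w i j z)%g.
Proof.
move=> Uz; rewrite conjgCV stwV // (conj_w_ji t ij jk ik) ?unitrN //.
by congr (x _ _ _ * _)%g; ring.
Qed.

Lemma XE t : t \in unit -> X t = (Y t^-1 * w i j t * Y t^-1)%g.
Proof.
move=> Ut; rewrite w_sym // stwE invrN invrK opprK !mulgA -YD subrr st0 // mul1g.
by rewrite -mulgA -YD addNr st0 // mulg1.
Qed.

Lemma YE t : t \in unit -> Y t = (X t^-1 * w i j (- t^-1) * X t^-1)%g.
Proof.
move=> Ut; rewrite stwE invrN invrK opprK !mulgA -XD subrr st0 // mul1g.
by rewrite -mulgA -XD addNr st0 // mulg1.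
Qed.

Lemma wwE a b : (w i j a * w i j b = H a * (H (- b))^-1)%g.
Proof. by rewrite hV // opprK sthE !mulgA mulgK. Qed.

(** The big cell factorisation of [[1, t], [b, 1 + bt]], kept free of any multiplicativity of [H].
    Writing x(t) as y w y merges its left letter with y(b) into y(v), [v] a unit; writing that as x
    w x brings the two Weyl elements together, and [wwE] turns them into diagonal elements. *)
Lemma yxD b t u : t \in unit -> u * (1 + b * t) = 1 ->
  (Y b * X t = X (t * u) * (H (- (t * u)) * (H (- t))^-1) * Y (b * u))%g.
Proof.
move=> Ut E; have Et := mulVr Ut.
have Ubt : 1 + b * t \in unit by apply/unitrPr; exists u; rewrite mulrC.
pose v := t^-1 * (1 + b * t); have Uv : v \in unit by rewrite unitrM unitrV Ut.
have Ev : v^-1 = t * u.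
  by apply: (mulIr Uv); rewrite mulVr // /v mulrACA mulrV // mul1r E.
rewrite (XE Ut) !mulgA -YD (_ : b + t^-1 = v); last by rewrite /v; ring: Et.
rewrite (YE Uv) -(mulgA _ (X _) (w i j t)) (wX _ Ut) !mulgA.
rewrite -(mulgA _ (w i j (- v^-1))) wwE Ev -mulgA -YD !mulgA; congr (_ * Y _)%g.
transitivity (t^-1 * (u * (1 + b * t)) - t^-1 * (t^-1 * (t * u))); first by rewrite E; ring.
by ring: Et.
Qed.

Lemma hNE u v : u \in unit -> v \in unit ->
  (H (u * - v)%R * (H (- v))^-1 = (symb u (- v))^-1 * H u)%g.
Proof. by move=> Uu Uv; rewrite symb_def !invgM invgK !mulgA mulgVK. Qed.

(* Moves y(s) to the right in y(s) x(1) x(1) x(1) = y(s) x(3), letter by letter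
   on the left and in one step on the right. *)
Lemma symb_dennis_stein s a b d :
    a * (1 + s) = 1 -> b * (1 + 2 * s) = 1 -> d * (1 + 3 * s) = 1 -> (3 : A) \in unit ->
  (symb a ((1 + s) * b) * symb b ((1 + 2 * s) * d) = (symb d 3)^-1)%g.
Proof.
move=> Ea Eb Ed U3.
have [Ua Ub Ud] : [/\ a \in unit, b \in unit & d \in unit].
  by split; apply/unitrPr; [exists (1 + s)|exists (1 + 2 * s)|exists (1 + 3 * s)].
have U1 := unitr1 A.
have Ua1 : 1 + s \in unit by apply/unitrPr; exists a; rewrite mulrC.
have Ub1 : 1 + 2 * s \in unit by apply/unitrPr; exists b; rewrite mulrC.
pose al := a; pose be := (1 + s) * b; pose ga := (1 + 2 * s) * d.
have Ube : be \in unit by rewrite unitrM Ua1.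
have Uga : ga \in unit by rewrite unitrM Ub1.
have step c e : e \in unit -> e * (1 + c) = 1 ->
  (Y c * X 1 = X e * ((symb e (- 1))^-1 * H e) * Y (c * e))%g.
  move=> Ue Ee; rewrite (@yxD _ _ e) ?mulr1 // mul1r; congr (_ * _ * _)%g.
  by rewrite -[- e]mulrN1 hNE.
have DX e z t : e \in unit -> z \in unit -> 
  ((symb e z)^-1 * H e * X t = X (e * (e * t)) * ((symb e z)^-1 * H e))%g.
  move=> Ue Uz; rewrite -mulgA hX // !mulgA; congr (_ * _)%g.
  by apply/commute_sym/commuteV/commute_sym/symb_cent.
have E4 := @yxD s 3 d U3 (_ : d * (1 + s * 3) = 1).
move: E4; rewrite [s * 3]mulrC => /(_ Ed).
rewrite (_ : - (3 * d) = d * - 3); last by ring.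
rewrite hNE // => E4.
have E1 : (Y s * X 1 = X al * ((symb al (- 1))^-1 * H al) * Y (s * al))%g by apply: step.
have E2 : (Y (s * al) * X 1 = X be * ((symb be (- 1))^-1 * H be) * Y (s * b))%g.
  rewrite (step _ be Ube); last first.
    transitivity (b * (1 + s + s * (a * (1 + s)))); first by rewrite /be /al; ring.
    by rewrite Ea -[RHS]Eb; ring.
  congr (_ * Y _)%g; transitivity (s * b * (a * (1 + s))); first by rewrite /be /al; ring.
  by rewrite Ea mulr1.
have E3 : (Y (s * b) * X 1 = X ga * ((symb ga (- 1))^-1 * H ga) * Y (s * d))%g.
  rewrite (step _ ga Uga); last first.
    transitivity (d * (1 + 2 * s + s * (b * (1 + 2 * s)))); first by rewrite /ga; ring.
    by rewrite Eb -[RHS]Ed; ring.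
  congr (_ * Y _)%g; transitivity (s * d * (b * (1 + 2 * s))); first by rewrite /ga; ring.
  by rewrite Eb mulr1.
have X3 : X 3 = (X 1 * X 1 * X 1)%g by rewrite -!XD; congr (X _); ring.
move: E4; rewrite X3 !mulgA E1 -(mulgA _ (Y _) (X 1)) E2 !mulgA -(mulgA _ (Y _) (X 1)) E3 !mulgA.
move/(mulIg (Y (s * d))).
have [Um1 Um3] : (-1 : A) \in unit /\ (-3 : A) \in unit by rewrite !unitrN.
have DX' e z t g : e \in unit -> z \in unit ->
  (g * (symb e z)^-1 * H e * X t = g * X (e * (e * t)) * (symb e z)^-1 * H e)%g.
  by move=> Ue Uz; have := DX e z t Ue Uz; rewrite -!mulgA => ->; rewrite !mulgA.
rewrite !DX' // -!XD.
have -> : al + al * (al * be) + al * (al * (be * (be * ga))) = 3 * d.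
  have Ealbe : al * be = b by rewrite /al /be mulrA Ea mul1r.
  have -> : al * (al * (be * (be * ga))) = b * d.
    transitivity ((al * be) * (al * be) * ga); first by ring.
    rewrite Ealbe /ga; transitivity (b * d * (b * (1 + 2 * s))); first by ring.
    by rewrite Eb mulr1.
  rewrite Ealbe.
  have -> : al + al * b = 2 * b.
    transitivity (al * (b * (1 + 2 * s) + b)); first by rewrite Eb; ring.
    transitivity (2 * b * (a * (1 + s))); first by rewrite /al; ring.
    by rewrite Ea mulr1.
  transitivity (b * (2 * (d * (1 + 3 * s)) + d)); first by rewrite Ed; ring.
  transitivity (3 * d * (b * (1 + 2 * s))); first by ring.
  by rewrite Eb mulr1.
rewrite -!mulgA => /mulgI.
have sc u v g : u \in unit -> v \in unit -> stcent g -> commute (symb u v)^-1%g g.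
  by move=> Uu Uv cg; apply/commute_sym/commuteV; rewrite symb_def;
     apply: commuteM; [apply: commuteM|apply: commuteV]; apply: stcent_h.
have sH u v e : u \in unit -> v \in unit -> commute (symb u v)^-1%g (H e).
  by move=> Uu Uv; apply/commute_sym/commuteV/commute_sym/stcent_h => //; apply: symb_cent.
have Ualbe : al * be = b by rewrite /al /be mulrA Ea mul1r.
have Ubga : b * ga = d by rewrite /ga mulrA Eb mul1r.
rewrite !mulgA -(mulgA _ (H al)) -(sH be (- 1)) // !mulgA.
rewrite -(mulgA _ (H be)) -(sH ga (- 1)) // !mulgA.
rewrite -(mulgA _ (H al)) -(sH ga (- 1)) // !mulgA.
rewrite -(mulgA _ (H al)) symbE // !mulgA -(mulgA _ (H _) (H ga)) symbE ?Ualbe // Ubga !mulgA.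
move/(mulIg (H d)).
have -> : ((symb al (-1))^-1 * (symb be (-1))^-1 * (symb ga (-1))^-1 = (symb d (-1))^-1)%g.
  rewrite -Ubga (symbMl Ub Uga Um1) -Ualbe (symbMl Ua Ube Um1) !invgM.
  have cV u v : u \in unit -> v \in unit ->
    commute (symb u (-1))^-1%g (symb v (-1))^-1%g.
    by move=> Uu Uv; apply/commuteV/commute_sym/commuteV/symbC.
  rewrite (cV al be) // -mulgA (cV al ga) // !mulgA.
  by rewrite (cV be ga).
rewrite -[- 3]mulN1r (symbMr Ud Um1 U3) invgM.
have -> : ((symb d 3)^-1 * (symb d (-1))^-1 = (symb d (-1))^-1 * (symb d 3)^-1)%g.
  by apply/commuteV/commute_sym/commuteV/symbC.
by rewrite -mulgA => /mulgI <-.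
Qed.

(** * Normal forms of words over a local ring *)

Section NormalForm.
Hypothesis Hm : forall u v, u \in unit -> v \in unit -> (H u * H v)%g = H (u * v).
Hypothesis loc : forall a b : A, a + b \in unit -> (a \in unit) || (b \in unit).
Lemma ww a b c : a \in unit -> b \in unit -> c \in unit -> a = - (c * b) ->
  (w i j a * w i j b = H c)%g.
Proof.
move=> Ua Ub Uc E; have Ub' : - b \in unit by rewrite unitrN.
apply: (mulIg (H (- b))); rewrite Hm // mulrN -E !sthE.
by rewrite -(stwV b ij) !mulgA mulgK.
Qed.

Lemma yx_unit b t u : u * (1 + b * t) = 1 -> (t \in unit) || (b \in unit) ->
  (Y b * X t = X (t * u) * H u * Y (b * u))%g.
Proof.
move=> E; have Uu : u \in unit.
  by apply/unitrPr; exists (1 + b * t).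
have Ubt : 1 + b * t \in unit by apply/unitrPr; exists u; rewrite mulrC.
case/orP=> [Ut|Ub].
  rewrite (yxD Ut E); congr (_ * _ * _)%g; apply: (mulIg (H (- t))).
  by rewrite mulgVK Hm ?unitrN // mulrN mulrC.
have Eb := mulVr Ub.
pose v := b^-1 * (1 + b * t); have Uv : v \in unit by rewrite unitrM unitrV Ub.
have Ev : v^-1 = b * u.
  by apply: (mulIr Uv); rewrite mulVr // /v mulrACA mulrV // mul1r E.
rewrite (YE Ub) -!mulgA -XD (_ : b^-1 + t = v); last by rewrite /v; ring: Eb.
rewrite (XE Uv) !mulgA -(mulgA _ (w i j (- b^-1)) (Y _)) wY // ?unitrN ?unitrV //.
rewrite !mulgA -XD -(mulgA _ (w i j _) (w i j _)) (@ww _ _ u) ?unitrN ?unitrV //; last first.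
  by rewrite /v mulrCA E mulr1.
rewrite Ev; congr (X _ * _ * _)%g.
transitivity (b^-1 * (u * (1 + b * t)) - b^-1 * (b^-1 * (b * u))); first by rewrite E; ring.
by ring: Eb.
Qed.

(** If neither letter is a unit, locality makes 1 + b and t - 1 units. Then x(t) = x(1) x(t - 1) is
    crossed in two steps, each with a unit upper letter. *)
Lemma yx b t u : u * (1 + b * t) = 1 ->
  (Y b * X t = X (t * u) * H u * Y (b * u))%g.
Proof.
move=> E; case: (boolP ((t \in unit) || (b \in unit))) => [|/norP[Ut Ub]].
  exact: yx_unit.
have UD c : c \notin unit -> forall e, e \in unit -> c + e \in unit.
  move=> Uc e Ue; have : c + e + - c \in unit by rewrite addrAC subrr add0r.
  by case/loc/orP => //; rewrite unitrN (negPf Uc).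
have U1b : 1 + b \in unit by rewrite addrC UD // unitr1.
have Ut1 : t - 1 \in unit by rewrite UD // unitrN1.
pose u1 := (1 + b)^-1; have E1 : u1 * (1 + b * 1) = 1 by rewrite mulr1 mulVr.
have E2 : ((1 + b) * u) * (1 + b * u1 * (t - 1)) = 1.
  have E1' : u1 * (1 + b) = 1 by rewrite mulVr.
  transitivity (u * ((1 + b) + b * (t - 1) * (u1 * (1 + b)))); first by ring.
  by rewrite E1' -[RHS]E; ring.
have Uu : u \in unit by apply/unitrPr; exists (1 + b * t).
have Uu1 : u1 \in unit by rewrite unitrV.
rewrite -{1}(subrK 1 t) [t - 1 + 1]addrC XD mulgA (yx_unit E1) ?unitr1 //.
rewrite -mulgA (yx_unit E2) ?Ut1 // !mulgA -(mulgA _ (H u1)) hX // !mulgA -XD.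
rewrite -(mulgA _ (H u1)) Hm // ?unitrM ?U1b //.
have E1' : u1 * (1 + b) = 1 by rewrite mulVr.
have Eu : u1 * ((1 + b) * u) = u by rewrite mulrA E1' mul1r.
rewrite Eu; congr (X _ * H _ * Y _)%g; last by rewrite -mulrA Eu.
transitivity (u1 * (1 + (t - 1) * (u1 * (1 + b)) * u)); first by ring.
transitivity ((u1 * (1 + b)) * (t * u)); last by rewrite E1' mul1r.
by rewrite [in LHS]E1' -[X in _ * (X + _)]E; ring.
Qed.

(* Over a local ring, every word is in the big cell X H Y or in its translate by
   a Weyl element; [nf] keeps track of the corresponding matrix, which
   determines the normal form. *)
Definition nf1 (g : G) (M : A * A * A * A) := exists a u v b, u * v = 1 /\
  g = (X a * H u * Y b)%g /\ M = (u + a * v * b, a * v, v * b, v).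

Definition mw (M : A * A * A * A) := let: (a, b, c, d) := M in (b, - a, d, - c).

Definition nf g M := nf1 g M \/ nf1 (g * w i j (-1))%g (mw M).

Lemma nf1Y g M t : nf1 g M -> nf1 (g * Y t)%g (mstep M (false, t)).
Proof.
move=> [a [u [v [b [E [-> ->]]]]]]; exists a, u, v, (b + t); split=> //.
by rewrite YD !mulgA /=; split=> //; congr (_, _, _, _); ring: E.
Qed.

Lemma nf1X g M t : nf1 g M -> nf (g * X t)%g (mstep M (true, t)).
Proof.
move=> [a [u [v [b [E [-> ->]]]]]].
have Uu : u \in unit by apply/unitrPr; exists v.
case: (boolP (1 + b * t \in unit)) => [Ubt|nUbt].
  pose u' := (1 + b * t)^-1; have E' : u' * (1 + b * t) = 1 by rewrite mulVr.
  have Uu' : u' \in unit by rewrite unitrV.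
  have E2 : u' * (b * t) = 1 - u' by rewrite -[in RHS]E'; ring.
  left; exists (a + u * (u * (t * u'))), (u * u'), (v * (1 + b * t)), (b * u'); split.
    by ring: E E2.
  rewrite -mulgA (yx E') !mulgA -(mulgA _ (H u)) hX // !mulgA -XD.
  rewrite -(mulgA _ (H u) (H u')) Hm //; split=> //=.
  by congr (_, _, _, _); ring: E E2.
have Ubt' : b * t \in unit.
  have : 1 + b * t + - (b * t) \in unit by rewrite addrK unitr1.
  by case/loc/orP; rewrite ?unitrN // (negPf nUbt).
have [Ub Ut] : b \in unit /\ t \in unit by apply/andP; rewrite -unitrM.
have Et := mulVr Ut.
(* Here the product leaves the big cell. Expanding x(t) as y(t^-1) w(t) y(t^-1) replaces b by the
   non-unit b + t^-1, and the extra factor w(-1) turns the rest into x(-t) H(t), so [yx] applies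
   again. *)
pose b' := b + t^-1.
have nUb' : b' \notin unit.
  apply: contra nUbt => Ub'; rewrite (_ : 1 + b * t = b' * t) ?unitrM ?Ub' //.
  by rewrite /b'; ring: Et.
have Ubt2 : 1 + b' * (- t) \in unit.
  have : 1 + b' * - t + b' * t \in unit.
    by rewrite -addrA mulrN addNr addr0 unitr1.
  by case/loc/orP => //; rewrite unitrM (negPf nUb').
pose u' := (1 + b' * - t)^-1; have E' : u' * (1 + b' * - t) = 1 by rewrite mulVr.
right; have -> : (X a * H u * Y b * X t * w i j (-1) = X a * H u * (Y b' * X (- t)) * H t)%g.
  rewrite (XE Ut) !mulgA -(mulgA _ (Y b)) -YD.
  rewrite -(mulgA _ (w i j t) (Y _)) wY // mulrV // mulr1 !mulgA.
  by rewrite -(mulgA _ (w i j t) (w i j _)) -sthE.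
have E3 : u' * (b * t) = -1.
  by rewrite -E' /b' -[RHS]opprK; ring: Et.
have Uu' : u' \in unit by rewrite unitrV.
exists (a + u * (u * (- t * u'))), (u * u' * t), (- (v * b)), (t * (t * (b' * u'))); split.
  by ring: E E3.
rewrite (yx E') !mulgA -(mulgA _ (H u)) hX // -!mulgA hY // !mulgA -XD.
rewrite -(mulgA _ (H u) (H u')) Hm // -(mulgA _ (H _) (H t)) Hm // ?unitrM ?Uu //; split=> //=.
by congr (_, _, _, _); rewrite /b'; ring: E E3 Et.
Qed.

Lemma nf1_neg g M : nf1 g M -> nf1 (g * w i j (-1) * w i j (-1))%g (mw (mw M)).
Proof.
have U1 : (-1 : A) \in unit by rewrite unitrN1.
move=> [a [u [v [b [E [-> ->]]]]]].
have Uu : u \in unit by apply/unitrPr; exists v.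
rewrite -!mulgA -sthE hY // !mulN1r opprK (mulgA (H u)) Hm // !mulgA.
exists a, (u * -1), (v * -1), b; split; first by ring: E.
by split=> //=; congr (_, _, _, _); ring: E.
Qed.

Lemma nf_step g M p : nf g M ->
  nf (g * (if p.1 then X p.2 else Y p.2))%g (mstep M p).
Proof.
have U1 : (-1 : A) \in unit by rewrite unitrN1.
case: p => [[] t] [N|N] /=.
- exact: nf1X.
- right; rewrite -mulgA wX // mulgA.
  move/(nf1Y (- ((-1)^-1 * ((-1)^-1 * t)))): N.
  move: M => [[[a b] c] d] /=; rewrite invrN1 !mulN1r !opprK; congr (nf1 _ _).
  by congr (_, _, _, _); ring.
- by left; apply: nf1Y N.
- have E : (Y t * w i j (-1) = w i j (-1) * X (- t))%g.
    rewrite conjgC (conj_w_ji t ij jk ik) //; congr (_ * X _)%g; ring.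
  case: (nf1X (- t) N) => N'.
    right; rewrite -mulgA E mulgA; move: N'; congr (nf1 _ _).
    by move: M {N} => [[[a b] c] d] /=; congr (_, _, _, _); ring.
  (* Since w(-1)^4 = H(-1)^2 = 1, the element g y(t) equals g w(-1) x(-t) w(-1)^3; the last two Weyl
     factors are absorbed by [nf1_neg]. *)
  have w4 : (w i j (-1) * w i j (-1) * w i j (-1) * w i j (-1) = 1)%g.
    by rewrite -mulgA -sthE Hm // mulrNN mulr1 h1.
  left; rewrite -[(g * Y t)%g]mulg1 -w4; move: (nf1_neg N').
  rewrite -(mulgA g) -E !mulgA; congr (nf1 _ _).
  by move: M {N N'} => [[[a b] c] d] /=; congr (_, _, _, _); ring.
Qed.

Lemma nf_word s : nf (wordg X Y s) (wordm s).
Proof.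
rewrite /wordg /wordm.
have : nf 1%g (1, 0, 0, 1).
  left; exists 0, 1, 1, 0; split; first by rewrite mul1r.
  rewrite h1 !st0 // !mul1g; split=> //; congr (_, _, _, _); ring.
elim: s 1%g (1, 0, 0, 1) => [|p s IH] g M //= N.
exact/IH/nf_step.
Qed.

(** For the identity matrix the big cell form has v = 1, which forces a = b = 0 and u = 1. The
    translated form would have v = 0, against u v = 1. *)
Lemma local_word s : (1 : A) != 0 -> wordm s = (1, 0, 0, 1) -> wordg X Y s = 1%g.
Proof.
move=> A1 E; have := nf_word s; rewrite E.
case=> [[a [u [v [b [uv [-> /= [E1 E2 E3 E4]]]]]]]|[a [u [v [b [uv [_ /= [E1 E2 E3 E4]]]]]]]].
  move: E1 E2 E3 uv; rewrite -E4 !mulr1 mul1r => _ <- <- ->.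
  by rewrite h1 !st0 // !mul1g.
by move: uv; rewrite -E4 oppr0 mulr0 => /esym/eqP; rewrite (negPf A1).
Qed.

End NormalForm.
End Symbol.

End Steinberg.

(** * Symbols over the integers modulo a prime power *)

(** The units are identified with the automorphisms of a cyclic group of order p^k, and the known
    structure of this automorphism group is cyclic for odd p. *)
Lemma Zp_units_gen p k : prime p -> odd p -> (0 < k)%N ->
  exists2 g : 'Z_(p ^ k), g \is a GRing.unit &
    forall u : 'Z_(p ^ k), u \is a GRing.unit -> exists n, u = g ^+ n.
Proof.
move=> pp op k0; set q := (p ^ k)%N; have q1 : (1 < q)%N.
  by rewrite -(exp1n k) ltn_exp2r // prime_gt1.
have cyc : cyclic (units_Zp q).
  have o1 : #[Zp1 : 'Z_q]%g = q by rewrite order_Zp1 Zp_cast.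
  have := Zp_unit_isog (Zp1 : 'Z_q); rewrite o1 => /isog_cyclic ->.
  have pG : (p.-group <[Zp1 : 'Z_q]>)%g by rewrite /pgroup -orderE o1 pnatX pnat_id.
  have ntG : <[Zp1 : 'Z_q]>%g != 1%g by rewrite -cardG_gt1 -orderE o1.
  have [m [_ [_ cF _ _]]] := cyclic_pgroup_Aut_structure pG (cycle_cyclic _) ntG.
  case: ifP => _; first by move=> /= EA; rewrite -EA in cF.
  by rewrite op => [[t [_ _ _ [[]]]]].
case/cyclicP: cyc => g gE; exists (FinRing.uval g); first exact: (valP g).
move=> u Uu; have : FinRing.Unit Uu \in units_Zp q by rewrite inE.
rewrite gE => /cycleP[n /(congr1 FinRing.uval)] /= ->; exists n.
by rewrite FinRing.val_unitX.
Qed.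

Lemma exp1D2 (A : comUnitRingType) (y : A) n : exists d, (1 + y) ^+ n = 1 + n%:R * y + y ^+ 2 * d.
Proof.
elim: n => [|n [d IH]]; first by exists 0; rewrite expr0 mul0r mulr0 !addr0.
exists (n%:R + d + y * d); rewrite exprS IH -natr1; ring.
Qed.

(** Each p-th power gains a factor p. For odd p these units have odd order, so a symbol of square 1
    does not see them. *)
Lemma Zp_1unit_order p k (c : 'Z_(p ^ k)) : (1 < p)%N -> (0 < k)%N ->
  (1 + p%:R * c) ^+ (p ^ k) = 1.
Proof.
move=> p1 k0; have q1 : (1 < p ^ k)%N by rewrite -(exp1n k) ltn_exp2r.
have H i : exists d, (1 + p%:R * c) ^+ (p ^ i) = 1 + p%:R ^+ i.+1 * d.
  elim: i => [|i [d IH]]; first by exists c; rewrite !expr1.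
  have [e E] := exp1D2 (p%:R ^+ i.+1 * d) p.
  exists (d + p%:R ^+ i * d ^+ 2 * e); rewrite expnSr exprM IH E !exprS; ring.
have [d ->] := H k.
by rewrite exprS -natrX pchar_Zp // mulr0 mul0r addr0.
Qed.

Section SymbPowers.
Variables (G : groupType) (A : comUnitRingType) (I : eqType) (x : I -> I -> A -> G).
Hypothesis xP : steinberg x.
Hypothesis third : forall i j : I, i != j -> exists2 k, j != k & i != k.
Variables (i j k : I).
Hypotheses (ij : i != j) (jk : j != k) (ik : i != k).
Local Notation symb := (symb x i j).
Local Notation unit := (GRing.unit : {pred A}).

Lemma symbXl u v n : u \in unit -> v \in unit -> symb (u ^+ n) v = (symb u v ^+ n)%g.
Proof.
move=> Uu Uv; elim: n => [|n IH]; first by rewrite expr0 expg0 (symb1l xP third ij jk ik).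
by rewrite exprS expgS (symbMl xP third ij jk ik) ?unitrX // IH.
Qed.

Lemma symbXr u v n : u \in unit -> v \in unit -> symb u (v ^+ n) = (symb u v ^+ n)%g.
Proof.
move=> Uu Uv; elim: n => [|n IH]; first by rewrite expr0 expg0 (symb1r xP third ij jk ik).
by rewrite exprS expgS (symbMr xP third ij jk ik) ?unitrX // IH.
Qed.

Lemma symbVl u v : u \in unit -> v \in unit -> symb u^-1 v = ((symb u v)^-1)%g.
Proof.
move=> Uu Uv; apply/esym/mulg1_eq.
by rewrite -(symbMl xP third ij jk ik) ?unitrV // divrr // (symb1l xP third ij jk ik).
Qed.

Lemma symbVr u v : u \in unit -> v \in unit -> symb u v^-1 = ((symb u v)^-1)%g.
Proof.
move=> Uu Uv; apply/esym/mulg1_eq.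
by rewrite -(symbMr xP third ij jk ik) ?unitrV // divrr // (symb1r xP third ij jk ik).
Qed.

Lemma symb_sq u : u \in unit -> (symb u u * symb u u = 1)%g.
Proof. by move=> Uu; rewrite {2}(symb_anti xP third ij jk ik Uu Uu) mulgV. Qed.

End SymbPowers.

Lemma expg_odd (G : groupType) (s : G) n : (s * s = 1)%g -> (s ^+ n = s ^+ (odd n))%g.
Proof.
move=> s2; rewrite -{1}(odd_double_half n) expgnDr -mul2n expgnA.
by rewrite (_ : s ^+ 2 = 1)%g ?expg1n ?mulg1 // expgS expg1.
Qed.

(* For a generator g of the units, all symbols are powers of s = {g, g} and
   s^2 = 1.  If s <> 1, let r + 1 be the least integer with {g, r + 1} <> 1: it is
   an odd power of g and r an even one, which contradicts the Steinberg relation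
   for 1 / (r + 1) + r / (r + 1) = 1. *)
Lemma symb_odd (G : groupType) (I : eqType) p k (x : I -> I -> 'Z_(p ^ k) -> G) i j l u v :
    prime p -> odd p -> (0 < k)%N -> steinberg x ->
    (forall i j : I, i != j -> exists2 k, j != k & i != k) ->
    i != j -> j != l -> i != l ->
    u \is a GRing.unit -> v \is a GRing.unit -> symb x i j u v = 1%g.
Proof.
move=> pp op k0 xP third ij jl il.
have p1 := prime_gt1 pp.
have q1 : (1 < p ^ k)%N by rewrite -(exp1n k) ltn_exp2r.
have [g Ug gen] := Zp_units_gen pp op k0.
set s := symb x i j g g.
have s2 : (s * s = 1)%g by exact: symb_sq xP third _ _ _ ij jl il _ Ug.
have gX a b : symb x i j (g ^+ a) (g ^+ b) = (s ^+ (a * b))%g.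
  by rewrite (symbXl xP third ij jl il) ?unitrX // (symbXr xP third ij jl il) // -expgnA mulnC.
suff s1 : s = 1%g.
  by move=> /gen[a ->] /gen[b ->]; rewrite gX s1 expg1n.
apply/eqP/negPn/negP => s1.
have sodd n : (s ^+ n == 1)%g = ~~ odd n.
  by rewrite (expg_odd _ s2); case: (odd n); rewrite ?expg1 ?(negPf s1) ?expg0 ?eqxx.
have Unat r : (0 < r < p)%N -> (r%:R : 'Z_(p ^ k)) \is a GRing.unit.
  move=> /andP[r0 rp]; rewrite unitZpE // coprime_pexpl // prime_coprime //.
  by rewrite gtnNdvd.
(* The generator factors as r v' with r its residue modulo p and v' congruent to 1 modulo p. As v'
   has odd order, {g, v'} = 1, so {g, r} = {g, g} is non-trivial. *)
have [r0 [r0p lr0]] : exists r, (0 < r < p)%N /\ symb x i j g r%:R != 1%g.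
  pose r := (g %% p)%N; exists r.
  have pg : ~~ (p %| g)%N.
    by move: Ug; rewrite -{1}(natr_Zp g) unitZpE // coprime_pexpl // prime_coprime.
  have r0p : (0 < r < p)%N by rewrite lt0n ltn_pmod ?prime_gt0 // andbT -/(dvdn p g).
  have Ur := Unat _ r0p; split=> //.
  pose c : 'Z_(p ^ k) := (g %/ p)%:R.
  have gE : g = r%:R * (1 + p%:R * (c / r%:R)).
    rewrite mulrDr mulr1 mulrCA (mulrC _ (c / _)) mulrVK // -natrM -natrD.
    by rewrite mulnC addnC -divn_eq natr_Zp.
  set v' := 1 + _ in gE.
  have Uv' : v' \is a GRing.unit by move: Ug; rewrite gE unitrM => /andP[].
  have lv : symb x i j g v' = 1%g.
    have [m vm] := gen _ Uv'.
    have := symbXr xP third ij jl il (p ^ k) Ug Uv'.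
    rewrite Zp_1unit_order // (symb1r xP third ij jl il) //.
    rewrite vm (symbXr xP third ij jl il) // -/s -expgnA => /esym/eqP.
    by rewrite sodd oddM oddX op orbT andbT -sodd => /eqP.
  apply: contra s1 => /eqP lr; rewrite /s {2}gE (symbMr xP third ij jl il) //.
  by rewrite lr lv mulg1.
have ex : exists r, (0 < r)%N && (symb x i j g r%:R != 1%g).
  by exists r0; case/andP: r0p => ->.
case: (ex_minnP ex) => r /andP[rpos lr] rmin.
have rp : (r < p)%N.
  by case/andP: r0p => r00 r0p; apply: leq_ltn_trans r0p; apply: rmin; rewrite r00.
have Ur : (r%:R : 'Z_(p ^ k)) \is a GRing.unit by rewrite Unat ?rpos.
case: r rpos lr rmin rp Ur => // r _ lr rmin rp Ur.
have rpos : (0 < r)%N.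
  case: r lr {rmin rp Ur} => // /eqP[].
  by rewrite (symb1r xP third ij jl il).
have Ur' : (r%:R : 'Z_(p ^ k)) \is a GRing.unit by rewrite Unat ?rpos ?(ltnW rp).
have lr' : symb x i j g r%:R = 1%g.
  apply/eqP/negPn/negP => lr'; have := rmin r; rewrite rpos lr' ltnn => /(_ isT).
  by [].
have [n rn] := gen _ Ur.
have Uri : (r.+1%:R : 'Z_(p ^ k))^-1 \is a GRing.unit by rewrite unitrV.
have st : symb x i j r.+1%:R^-1 (r%:R * r.+1%:R^-1) = 1%g.
  apply: (symb_steinberg xP third ij jl il) => //; first by rewrite unitrM Ur'.
  by rewrite -{1}[_^-1]mul1r -mulrDl nat1r divrr.
have U2 : (r%:R : 'Z_(p ^ k)) * r.+1%:R^-1 \is a GRing.unit by rewrite unitrM Ur'.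
move: st; rewrite (symbVl xP third ij jl il) // {1}rn (symbXl xP third ij jl il) //.
rewrite (symbMr xP third ij jl il) // lr' mul1g (symbVr xP third ij jl il) //.
rewrite {1}rn (symbXr xP third ij jl il) // -/s => /eqP.
rewrite expVgn invgK -expgnA sodd oddM andbb => /negP[].
move: lr; rewrite rn (symbXr xP third ij jl il) // -/s.
by rewrite sodd negbK.
Qed.

(** * Units modulo powers of two *)

Lemma pow25 j : exists o : int, 25 ^+ (2 ^ j) = 1 + 2 ^+ j.+3 * (1 + 2 * o).
Proof.
elim: j => [|j [o IH]]; first by exists 1.
exists (o + 2 ^+ j * 2 * (1 + 2 * o) ^+ 2).
rewrite expnSr exprM IH !exprS; ring.
Qed.

Lemma int_parity (c : int) : exists e, c = 2 * e \/ c = 1 + 2 * e.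
Proof. by exists (c %/ 2)%Z; lia. Qed.

Lemma pow25_odd n : exists f : int, 25 ^+ n = 1 + 2 * f.
Proof.
elim: n => [|n [f IH]]; first by exists 0.
by exists (12 + 25 * f); rewrite exprS IH; ring.
Qed.

(** Digit by digit: when the error [d] is odd, the factor 25^(2^j), which is 1 plus an odd multiple
    of 2^(j+3), corrects the next binary digit and disturbs none below. The base 25 is the square of
    5, so that symbols of its powers are reached through {5, -}. *)
Lemma pow25_approx (c : int) j : exists n (d : int), 1 + 8 * c = 25 ^+ n + 2 ^+ j.+3 * d.
Proof.
elim: j => [|j [n [d IH]]]; first by exists 0%N, c; rewrite expr0.
have [e [dE|dE]] := int_parity d.
  by exists n, e; rewrite IH dE !exprS; ring.
have [o oE] := pow25 j; have [f fE] := pow25_odd n.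
exists (n + 2 ^ j)%N, (e - f - o * (1 + 2 * f)).
by rewrite IH exprD oE dE fE !exprS; ring.
Qed.

Section ZmodPow2.
Variable k : nat.
Local Notation A := 'Z_(2 ^ k.+1).
Local Notation unit := (GRing.unit : {pred A}).

Lemma exp2S_gt1 : (1 < 2 ^ k.+1)%N.
Proof. by rewrite expnS; have := expn_gt0 2 k; lia. Qed.

Lemma unit2 (n : nat) : ((n%:R : A) \is a GRing.unit) = odd n.
Proof. by rewrite unitZpE ?exp2S_gt1 // coprime_pexpl // coprime2n. Qed.

Lemma pow25_Zp (c : A) : exists n, 1 + 8 * c = 25 ^+ n.
Proof.
have z0 : (2 : A) ^+ k.+3 = 0.
  by rewrite -[k.+3]addn2 exprD -(natrX _ 2 k.+1) pchar_Zp ?exp2S_gt1 ?mul0r.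
have [n [d E]] := pow25_approx (c : nat)%:Z k; exists n.
move: E => /(congr1 (intr : int -> A)).
have iX m e : (m ^+ e)%:~R = m%:~R ^+ e :> A by rewrite rmorphXn.
rewrite !intrD (intrM _ 8) (intrM _ (2 ^+ k.+3)) !iX.
rewrite !rmorph_nat z0 -pmulrn.
by rewrite natr_Zp mul0r addr0.
Qed.

(** Units modulo 8 are their own inverses, with representatives 1, -1, 5, -5; thus u e = 1 modulo 8
    expresses that u and e are congruent modulo 8. *)
Lemma Zp2_class (u : A) : u \is a GRing.unit ->
  exists2 e, e \in [:: 1; -1; 5; -5] & exists c, u * e = 1 + 8 * c.
Proof.
rewrite -{1}(natr_Zp u) unit2 => ou.
have E : u = 8 * (u %/ 8)%N%:R + (u %% 8)%N%:R :> A.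
  by rewrite -natrM -natrD mulnC -divn_eq natr_Zp.
have : odd (u %% 8) by lia.
have : (u %% 8 < 8)%N by rewrite ltn_pmod.
set m := (u %/ 8)%N%:R in E.
case: (u %% 8)%N E => [|[|[|[|[|[|[|[|]]]]]]]] // E _ _.
- by exists 1; rewrite ?inE ?eqxx ?orbT //; exists m; rewrite E; ring.
- by exists (- 5); rewrite ?inE ?eqxx ?orbT //; exists (- 5 * m - 2); rewrite E; ring.
- by exists 5; rewrite ?inE ?eqxx ?orbT //; exists (5 * m + 3); rewrite E; ring.
- by exists (- 1); rewrite ?inE ?eqxx ?orbT //; exists (- m - 1); rewrite E; ring.
Qed.

Lemma Zp2_sq (u : A) : u \is a GRing.unit -> exists c, u * u = 1 + 8 * c.
Proof.
rewrite -{1}(natr_Zp u) unit2 => ou.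
pose m := (u : nat)./2; pose t := (m * m.+1)./2.
have tE : (t.*2 = m * m.+1)%N by rewrite even_halfK // oddM oddS andbN.
have uE : (u : nat) = (1 + m.*2)%N by have := odd_double_half u; rewrite ou.
exists t%:R; rewrite -[in LHS](natr_Zp u) uE -natrM -[1]/(1%:R) -[8 * _]natrM -natrD.
by congr (_%:R); lia.
Qed.

End ZmodPow2.

(** * Vanishing of symbols modulo powers of two *)

Section Even.
Variables (G : groupType) (I : eqType) (A : comUnitRingType) (x : I -> I -> A -> G).
Hypothesis xP : steinberg x.
Hypothesis third : forall i j : I, i != j -> exists2 k, j != k & i != k.
Variables (i j l : I).
Hypotheses (ij : i != j) (jl : j != l) (il : i != l).
Local Notation unit := (GRing.unit : {pred A}).
Local Notation symb := (symb x i j).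
Hypothesis w4 : (stw x i j 1 ^+ 4 = 1)%g.
Hypothesis (U3 : (3 : A) \in unit) (U5 : (5 : A) \in unit) (U7 : (7 : A) \in unit).
Hypothesis pow25 : forall c : A, exists n, 1 + 8 * c = 25 ^+ n.
Hypothesis class : forall u : A, u \in unit ->
  exists2 e, e \in [:: 1; -1; 5; -5] & exists c, u * e = 1 + 8 * c.
Hypothesis sq1mod8 : forall u : A, u \in unit -> exists c, u * u = 1 + 8 * c.

Let sMl := symbMl xP third ij jl il.
Let sMr := symbMr xP third ij jl il.
Let s1l := symb1l xP third ij jl il.
Let s1r := symb1r xP third ij jl il.
Let sXl := symbXl xP third ij jl il.
Let sXr := symbXr xP third ij jl il.
Let sA := symb_anti xP third ij jl il.
Let U1 : (1 : A) \in unit. Proof. exact: unitr1. Qed.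
Let UN1 : (-1 : A) \in unit. Proof. by rewrite unitrN1. Qed.
Let UN5 : (-5 : A) \in unit. Proof. by rewrite unitrN. Qed.
Let E25 : 25 = 5 * 5 :> A. Proof. ring. Qed.

(* Squares of units are 1 modulo 8, hence powers of 25; so symbols only depend
   on classes modulo 8, and {-1, -1}, {-1, 5}, {5, 5} are all that is left. *)
Lemma symb5_sq z : z \in unit -> (symb 5 z * symb 5 z = 1)%g.
Proof.
move=> Uz; have s55 : (symb 5 5 * symb 5 5 = 1)%g by apply: (symb_sq xP third ij jl il).
have [e eP [c]] := class Uz; have [n ->] := pow25 c => Ec.
have Ue : e \in unit by move: eP; rewrite !inE => /or4P[] /eqP ->.
have E : (symb 5 z * symb 5 e = 1)%g.
  by rewrite -sMr // Ec sXr ?unitrM ?U5 ?E25 // ?unitrM ?U5 // sMr // s55 expg1n.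
have -> : symb 5 z = ((symb 5 e)^-1)%g by rewrite -[LHS]mulg1 -(mulgV (symb 5 e)) mulgA E mul1g.
rewrite -invgM -sMr // -[RHS]invg1; congr (_^-1)%g.
move: eP; rewrite !inE => /or4P[] /eqP ->; rewrite ?mulrNN ?mulr1 ?s1r //.
  by rewrite sMr.
by rewrite sMr.
Qed.

Lemma symb_1mod8 c z : z \in unit -> symb (1 + 8 * c) z = 1%g.
Proof.
move=> Uz; have [n ->] := pow25 c.
by rewrite sXl ?E25 ?unitrM ?U5 // sMl // symb5_sq // expg1n.
Qed.

Lemma symb2_sq u z : u \in unit -> z \in unit -> (symb u z * symb u z = 1)%g.
Proof.
by move=> Uu Uz; rewrite -sMl //; have [c ->] := sq1mod8 Uu; rewrite symb_1mod8.
Qed.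

Lemma symb2_inv u z : u \in unit -> z \in unit -> ((symb u z)^-1)%g = symb u z.
Proof. by move=> Uu Uz; apply/mulg1_eq/symb2_sq. Qed.

Lemma symb_classl u e c z : u \in unit -> e \in unit -> z \in unit ->
  u * e = 1 + 8 * c -> symb u z = symb e z.
Proof.
move=> Uu Ue Uz E; rewrite -(symb2_inv Uu Uz).
by apply/mulg1_eq; rewrite -sMl // E symb_1mod8.
Qed.

Lemma symb_classr u e c z : u \in unit -> e \in unit -> z \in unit ->
  u * e = 1 + 8 * c -> symb z u = symb z e.
Proof.
by move=> Uu Ue Uz E; rewrite sA // (symb_classl Uu Ue Uz E) -sA.
Qed.

(** {-1, -1} = H(-1)^2 = w(-1)^4; this is the symbol for which [w4] is assumed. *)
Lemma symb_N1N1 : symb (-1) (-1) = 1%g.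
Proof.
rewrite symb_def mulrNN mulr1 (h1 xP ij) invg1 mulg1 sthE -(stwV xP _ ij).
by rewrite -!invgM -!mulgA -[RHS]invg1 -w4.
Qed.

Local Notation B := (symb (-1) 5).
Local Notation E := (symb 5 5).
Let s5N1 : symb 5 (-1) = B. Proof. by rewrite sA // symb2_inv. Qed.
Let sN5 z : z \in unit -> symb (-5) z = (symb (-1) z * symb 5 z)%g.
Proof. by move=> Uz; rewrite -sMl // mulN1r. Qed.
Let sN5r z : z \in unit -> symb z (-5) = (symb z (-1) * symb z 5)%g.
Proof. by move=> Uz; rewrite -sMr // mulN1r. Qed.
Let BB : (B * B = 1)%g. Proof. exact: symb2_sq. Qed.

(** The value s = 2 gives the chain of units 1, 3, 5, 7. Reduced modulo 8, the relation reads {-5,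
    -1} {5, -5} = {-1, -5}^-1, where everything except [E] and [B] cancels. *)
Lemma symb_55_N15 : E = B.
Proof.
have [c3 c5 c7] : [/\ 3^-1 * 3 = 1 :> A, 5^-1 * 5 = 1 :> A & 7^-1 * 7 = 1 :> A].
  by rewrite !mulVr.
have [Ui3 Ui5 Ui7] : [/\ (3^-1 : A) \in unit, (5^-1 : A) \in unit & (7^-1 : A) \in unit].
  by rewrite !unitrV.
have := symb_dennis_stein xP third ij jl il (s := 2) (a := 3^-1) (b := 5^-1) (d := 7^-1).
have e3 : (1 + 2 : A) = 3 by ring.
have e5 : (1 + 2 * 2 : A) = 5 by ring.
have e7 : (1 + 3 * 2 : A) = 7 by ring.
rewrite e3 e5 e7 => /(_ c3 c5 c7 U3).
rewrite (symb_classl (e := -5) (c := - 3^-1) Ui3) ?unitrM ?U3 //; last first.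
  by rewrite -[X in _ = X + _]c3; ring.
rewrite (symb_classr (u := 3 * 5^-1) (e := -1) (c := - 5^-1)) ?unitrM ?U3 //; last first.
  by rewrite -[X in _ = X + _]c5; ring.
rewrite (symb_classl (u := 5^-1) (e := 5) (c := 0)) ?unitrM ?U5 //; last first.
  by rewrite c5 mulr0 addr0.
rewrite (symb_classr (u := 5 * 7^-1) (e := -5) (c := - 4 * 7^-1)) ?unitrM ?U5 //; last first.
  by rewrite -[X in _ = X + _]c7; ring.
rewrite (symb_classl (u := 7^-1) (e := -1) (c := - 7^-1)) //; last first.
  by rewrite -[X in _ = X + _]c7; ring.
rewrite (symb_classr (u := 3) (e := -5) (c := - 2)) //; last by ring.
rewrite sN5 // sN5r // sN5r // symb_N1N1 s5N1 !mul1g mulgA BB mul1g => ->.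
by rewrite symb2_inv.
Qed.

(** The value s = -2 gives the chain 1, -1, -3, -5. Modulo 8 the relation becomes {-1, -5} {5, -1} =
    {-5, -5}^-1: the left side is B^2 = 1 and the right side reduces to [E] up to inversion. *)
Lemma symb_55 : E = 1%g.
Proof.
have [c3 c5] : 3^-1 * 3 = 1 :> A /\ 5^-1 * 5 = 1 :> A by rewrite !mulVr.
have [Ui3 Ui5] : (3^-1 : A) \in unit /\ (5^-1 : A) \in unit by rewrite !unitrV.
have := symb_dennis_stein xP third ij jl il (s := -2) (a := -1) (b := - 3^-1) (d := - 5^-1).
have e1 : (1 - 2 : A) = -1 by ring.
have e3 : (1 + 2 * -2 : A) = -3 by ring.
have e5 : (1 + 3 * -2 : A) = -5 by ring.
rewrite e1 e3 e5 !mulrNN mulr1 => /(_ (erefl _) c3 c5 U3).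
rewrite mul1r.
rewrite (symb_classr (u := 3^-1) (e := -5) (c := - 3^-1)) ?unitrM ?U3 //; last first.
  by rewrite -[X in _ = X + _]c3; ring.
rewrite (symb_classl (u := - 3^-1) (e := 5) (c := - 3^-1)) ?unitrN ?unitrM ?U3 //; last first.
  by rewrite -[X in _ = X + _]c3; ring.
rewrite (symb_classr (u := 3 * 5^-1) (e := -1) (c := - 5^-1)) ?unitrM ?U3 //; last first.
  by rewrite -[X in _ = X + _]c5; ring.
rewrite (symb_classl (u := - 5^-1) (e := -5) (c := 0)) ?unitrN //; last first.
  by rewrite mulrNN c5 mulr0 addr0.
rewrite (symb_classr (u := 3) (e := -5) (c := - 2)) //; last by ring.
rewrite sN5 // !sN5r // symb_N1N1 s5N1 !mul1g BB symb_55_N15 BB mulg1.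
by rewrite symb2_inv.
Qed.

Lemma symb_even u v : u \in unit -> v \in unit -> symb u v = 1%g.
Proof.
move=> Uu Uv.
have [e eP [c Ec]] := class Uu; have [f fP [d Ed]] := class Uv.
have Ue : e \in unit by move: eP; rewrite !inE => /or4P[] /eqP ->.
have Uf : f \in unit by move: fP; rewrite !inE => /or4P[] /eqP ->.
rewrite (symb_classl Uu Ue Uv Ec) (symb_classr Uv Uf Ue Ed) {Ec Ed c d Ue}.
have E1 := symb_55; have B1 := symb_55_N15; rewrite E1 in B1.
move: eP; rewrite !inE => /or4P[] /eqP ->; rewrite ?s1l //;
  move: fP Uf; rewrite !inE => /or4P[] /eqP -> Uf; rewrite ?s1r //.
all: by rewrite ?sN5 // ?sN5r // ?symb_N1N1 ?s5N1 ?E1 -?B1 ?mulg1.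
Qed.

End Even.

(** * Words in two elementary generators *)

Definition mmap (A B : Type) (f : A -> B) (M : A * A * A * A) :=
  let: (a, b, c, d) := M in (f a, f b, f c, f d).

Definition wmap (A B : Type) (f : A -> B) (s : seq (bool * A)) := [seq (p.1, f p.2) | p <- s].

Lemma wordm_map (A B : comUnitRingType) (f : {rmorphism A -> B}) s :
  wordm (wmap f s) = mmap f (wordm s).
Proof.
rewrite /wordm -[(1, 0, 0, 1) in LHS]/(1 : B, 0 : B, 0 : B, 1 : B).
have -> : (1, 0, 0, 1) = mmap f (1, 0, 0, 1) by rewrite /= rmorph1 rmorph0.
elim: s (1, 0, 0, 1) => //= -[b t] s IH [[[a c] d] e] /=.
rewrite -IH; congr (foldl _ _ _).
by case: b => /=; rewrite !rmorphD !rmorphM.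
Qed.

Lemma wordg_map (G : groupType) (A B : Type) (f : A -> B) (X Y : B -> G) s :
  wordg X Y (wmap f s) = wordg (X \o f) (Y \o f) s.
Proof.
by rewrite /wordg; elim: s 1%g => //= -[b t] s IH g /=; rewrite IH; case: b.
Qed.

Lemma eq_wordg (G : groupType) (A : Type) (X Y X' Y' : A -> G) s :
  X =1 X' -> Y =1 Y' -> wordg X Y s = wordg X' Y' s.
Proof.
move=> EX EY; rewrite /wordg; elim: s 1%g => //= -[b t] s IH g /=.
by rewrite EX EY IH.
Qed.

Lemma wordgM (G : groupType) (A : Type) (X Y X' Y' X'' Y'' : A -> G) s :
  (forall t, X t = X' t * X'' t)%g -> (forall t, Y t = Y' t * Y'' t)%g ->
  (forall t u, commute (X' t) (X'' u)) -> (forall t u, commute (X' t) (Y'' u)) ->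
  (forall t u, commute (Y' t) (X'' u)) -> (forall t u, commute (Y' t) (Y'' u)) ->
  wordg X Y s = (wordg X' Y' s * wordg X'' Y'' s)%g.
Proof.
move=> EX EY XX XY YX YY; rewrite /wordg.
suff H g' g'' : (forall t, commute (X' t) g'') -> (forall t, commute (Y' t) g'') ->
    foldl (fun g p => g * (if p.1 then X p.2 else Y p.2))%g (g' * g'')%g s =
    (foldl (fun g p => g * (if p.1 then X' p.2 else Y' p.2)) g' s *
     foldl (fun g p => g * (if p.1 then X'' p.2 else Y'' p.2)) g'' s)%g.
  by rewrite -[1%g in LHS]mulg1 H // => t; apply: commute1.
elim: s g' g'' => //= -[b t] s IH g' g'' cX cY /=; rewrite -IH.
- congr (foldl _ _ _); case: b; rewrite ?EX ?EY !mulgA; congr (_ * _)%g.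
    by rewrite -!mulgA cX.
  by rewrite -!mulgA cY.
- by move=> u; apply: commuteM (cX u) _; case: b.
- by move=> u; apply: commuteM (cY u) _; case: b.
Qed.

Lemma intr_Zp_eq0 q (t : int) : (1 < q)%N -> (t%:~R == 0 :> 'Z_q) = (q %| `|t|)%N.
Proof.
move=> q1; have N n : ((n%:R : 'Z_q) == 0) = (q %| n)%N.
  by rewrite -val_eqE /= val_Zp_nat.
by case: t => n; rewrite ?NegzE ?abszN ?mulrNz ?oppr_eq0 absz_nat -pmulrn N.
Qed.

(** * Integer words of level Q *)

Section IntWords.
Variables (G : groupType) (I : eqType).
Hypothesis third : forall i j : I, i != j -> exists2 k, j != k & i != k.
Variables (i j l : I).
Hypotheses (ij : i != j) (jl : j != l) (il : i != l).
Let ji : j != i. Proof. by rewrite eq_sym. Qed.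

Definition level1 (x : I -> I -> int -> G) (Q : nat) := forall a b, a != b -> x a b Q%:Z = 1%g.

Lemma level1_dvd x Q a b t : steinberg x -> level1 x Q -> a != b -> (Q %| `|t|)%N -> x a b t = 1%g.
Proof.
move=> xP lQ ab Qt; have [k bk ak] := third ab.
have /divzK <- : (Q%:Z %| t)%Z by rewrite dvdzE.
rewrite mulrC.
by rewrite -(st_comm xP _ _ ab bk ak) lQ // comm1g.
Qed.

Lemma level1_eqm x Q a b t u : steinberg x -> level1 x Q -> a != b ->
  (Q %| `|t - u|)%N -> x a b t = x a b u.
Proof.
move=> xP lQ ab Qt; rewrite -[t](subrK u) (stD xP) //.
by rewrite (level1_dvd xP lQ ab Qt) mul1g.
Qed.

Lemma steinberg_mod x q : (1 < q)%N -> steinberg x -> level1 x q ->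
  steinberg (fun a b (t : 'Z_q) => x a b (t : nat)%:Z).
Proof.
move=> q1 xP lq.
have E a b (t : 'Z_q) (u : int) : a != b -> t = u%:~R -> x a b (t : nat)%:Z = x a b u.
  move=> ab tu; apply: (level1_eqm xP lq ab); rewrite -intr_Zp_eq0 //.
  by rewrite intrB -[X in X - _]pmulrn natr_Zp tu subrr.
have nE (t : 'Z_q) : (t : nat)%:~R = t :> 'Z_q by rewrite -pmulrn natr_Zp.
split.
- move=> a b t u ab; rewrite -(stD xP) //; apply: E => //.
  by rewrite intrD !nE.
- move=> a b c t u ab bc ac; rewrite (stR xP) //; congr (_ * _)%g.
  by apply/esym/E => //; rewrite intrM !nE.
- by move=> *; apply: (stC xP).
Qed.

(* The word w^4, for w = x_12(1) x_21(-1) x_12(1). *)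
Definition w4word : seq (bool * int) :=
  flatten (nseq 4 [:: (true, 1); (false, -1); (true, 1)]).

Lemma w4_wordm : wordm w4word = (1, 0, 0, 1).
Proof. by []. Qed.

Definition eqm1 (Q : nat) (M : int * int * int * int) :=
  let: (a, b, c, d) := M in
  [&& (Q %| `|a - 1|)%N, (Q %| `|b|)%N, (Q %| `|c|)%N & (Q %| `|d - 1|)%N].

Lemma prime_power_word x p k s : prime p -> steinberg x -> level1 x (p ^ k.+1) ->
  (p = 2 -> wordg (x i j) (x j i) w4word = 1%g) ->
  eqm1 (p ^ k.+1) (wordm s) -> wordg (x i j) (x j i) s = 1%g.
Proof.
move=> pp xP lq w4 ms; set q := (p ^ k.+1)%N in lq ms.
have q1 : (1 < q)%N by rewrite /q expnS; have := prime_gt1 pp; have := expn_gt0 p k; nia.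
pose y a b (t : 'Z_q) := x a b (t : nat)%:Z.
have yP : steinberg y := steinberg_mod q1 xP lq.
have yE a b (t : int) : a != b -> y a b t%:~R = x a b t.
  move=> ab; apply: (level1_eqm xP lq ab); rewrite -intr_Zp_eq0 //.
  by rewrite intrB -[X in X - _]pmulrn natr_Zp subrr.
have yw r : wordg (x i j) (x j i) r = wordg (y i j) (y j i) (wmap intr r).
  by rewrite wordg_map; apply: eq_wordg => t /=; rewrite yE.
have loc (a b : 'Z_q) : a + b \is a GRing.unit -> (a \is a GRing.unit) || (b \is a GRing.unit).
  have U (u : 'Z_q) : (u \is a GRing.unit) = ~~ (p %| u)%N.
    by rewrite -{1}(natr_Zp u) unitZpE // coprime_pexpl // prime_coprime.
  rewrite !U -negb_and; apply: contra => /andP[pa pb].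
  have -> : ((a + b)%R : nat) = (((a : nat) + (b : nat)) %% q)%N.
    by rewrite -{1}(natr_Zp a) -{1}(natr_Zp b) -natrD val_Zp_nat.
  rewrite /dvdn modn_dvdm ?dvdn_exp //.
  by rewrite -/(dvdn _ _) dvdn_add.
have symb1 u v : u \is a GRing.unit -> v \is a GRing.unit -> symb y i j u v = 1%g.
  have [p2|op] := even_prime pp; last exact: symb_odd pp op _ yP third ij jl il.
  have U r : odd r -> (r%:R : 'Z_q) \is a GRing.unit.
    by move=> r_odd; rewrite unitZpE // coprime_pexpl // p2 coprime2n.
  subst p; apply: (symb_even yP third ij jl il); try exact: U.
  - move: (w4 erefl); rewrite yw /w4word /= /wordg /= => <-.
    rewrite !expgS expg0 !stwE mulg1 invr1 mul1g rmorph1 rmorphN1.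
    by rewrite !mulgA.
  - exact: pow25_Zp.
  - exact: Zp2_class.
  - exact: Zp2_sq.
rewrite yw; apply: (local_word yP third ij jl il _ loc).
- by move=> u v Uu Uv; rewrite symbE // symb1 // mul1g.
- by rewrite oner_eq0.
rewrite wordm_map; case: (wordm s) ms => [[[a b] c] d] /= /and4P[].
rewrite -!intr_Zp_eq0 // !intrB !subr_eq0 => /eqP -> /eqP -> /eqP -> /eqP ->.
by [].
Qed.

(* An idempotent e modulo Q splits the Steinberg system x into the commuting
   systems x(e t) and x((1 - e) t). *)
Section Split.
Variables (x : I -> I -> int -> G) (Q : nat) (e : int).
Hypotheses (xP : steinberg x) (lQ : level1 x Q) (eQ : (Q %| `|(e * e - e)%R|)%N).
Local Notation x1 := (fun a b t => x a b (e * t)).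
Local Notation x2 := (fun a b t => x a b ((1 - e) * t)).

Lemma eQN : (Q %| `|((1 - e) * (1 - e) - (1 - e))%R|)%N.
Proof. by rewrite (_ : (1 - e) * (1 - e) - (1 - e) = e * e - e) //; ring. Qed.

Lemma steinberg_idem (f : int) : (Q %| `|(f * f - f)%R|)%N -> steinberg (fun a b t => x a b (f * t)).
Proof.
move=> fQ; split.
- by move=> a b t u ab; rewrite mulrDr (stD xP).
- move=> a b c t u ab bc ac; rewrite (stR xP) //; congr (_ * _)%g.
  apply: (level1_eqm xP lQ ac).
  rewrite (_ : f * t * (f * u) - f * (t * u) = (f * f - f) * (t * u)); last by ring.
  by rewrite abszM dvdn_mulr.
- by move=> *; apply: (stC xP).
Qed.

Lemma split_off a b c d t u : a != b -> c != d -> ~~ ((a == d) && (b == c)) ->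
  commute (x1 a b t) (x2 c d u).
Proof.
move=> ab cd nop.
have Z (v w : int) : (Q %| `|(e * v * ((1 - e) * w))%R|)%N.
  rewrite (_ : e * v * ((1 - e) * w) = (e * e - e) * - (v * w)); last by ring.
  by rewrite abszM dvdn_mulr.
case: (eqVneq b c) nop => [bc|bc].
  subst c; rewrite andbT => ad; rewrite /commute /= (stR xP) //.
  by rewrite (level1_dvd xP lQ ad) ?mulg1.
move=> _; case: (eqVneq a d) => [ad|ad]; last exact: (stC xP).
have cb : c != b by rewrite eq_sym.
subst d; apply/commute_sym; rewrite /commute /= (stR xP) //.
by rewrite (level1_dvd xP lQ cb) ?mulg1 // mulrC.
Qed.

Lemma split_comm a b c d t u : a != b -> c != d -> commute (x1 a b t) (x2 c d u).
Proof.
move=> ab cd; case: (boolP ((a == d) && (b == c))); last exact: split_off.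
case/andP=> /eqP ad /eqP bc; subst c d; have [k bk ak] := third ab.
have -> : x a b (e * t) = [~ x1 a k t, x1 k b 1%R]%g.
  rewrite (st_comm (steinberg_idem eQ)) // ?mulr1 //.
have ka : k != a by rewrite eq_sym.
have kb : k != b by rewrite eq_sym.
have C1 : commute (x2 b a u) (x1 a k t).
  by apply/commute_sym/split_off; rewrite // negb_and kb orbT.
have C2 : commute (x2 b a u) (x1 k b 1%R).
  by apply/commute_sym/split_off; rewrite // negb_and ka.
apply/commute_sym; rewrite /commg.
by apply: commuteM; [apply: commuteV|apply: commuteM; [apply: commuteV|apply: commuteM]].
Qed.

Lemma split_word s :
  wordg (x i j) (x j i) s = (wordg (x1 i j) (x1 j i) s * wordg (x2 i j) (x2 j i) s)%g.
Proof.
apply: wordgM; try by move=> t u; apply: split_comm.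
  by move=> t; rewrite -(stD xP) // -mulrDl subrKC mul1r.
by move=> t; rewrite -(stD xP) // -mulrDl subrKC mul1r.
Qed.

End Split.

Lemma eqm1_dvd Q Q' M : (Q %| Q')%N -> eqm1 Q' M -> eqm1 Q M.
Proof.
move=> QQ; case: M => [[[a b] c] d] /and4P[*].
by apply/and4P; split; apply: dvdn_trans QQ _.
Qed.

Lemma pow2_or_odd Q : (0 < Q)%N -> (exists k, Q = 2 ^ k)%N \/
  exists p k m, [/\ prime p, odd p, (0 < m)%N, coprime (p ^ k.+1) m & Q = p ^ k.+1 * m]%N.
Proof.
move=> Q0; pose m := (Q`_2^')%N.
have [m1|m1] := eqVneq m 1%N.
  by left; exists (logn 2%N Q); rewrite -p_part -{1}(partnC 2%N Q0) -/m m1 muln1.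
right; pose p := pdiv m; have pp : prime p by rewrite pdiv_prime // ltn_neqAle eq_sym m1 part_gt0.
have pm : (p %| m)%N by exact: pdiv_dvd.
have pQ : (p %| Q)%N by apply: dvdn_trans pm (dvdn_part _ _).
have lp : (0 < logn p Q)%N by rewrite logn_gt0 mem_primes pp Q0.
exists p, (logn p Q).-1, (Q`_p^')%N; split=> //.
- have := part_pnat (2^')%N Q; rewrite -/m => /(pnatP _ (part_gt0 _ _)) /(_ p pp pm); rewrite !inE /=.
  by case: (even_prime pp) => [->|].
- by rewrite prednK // -p_part coprime_partC.
- by rewrite prednK // -p_part partnC.
Qed.

(** Induction on Q that removes one odd prime power at a time. This order lets the hypothesis on
    [w4word] survive down to the final power of two. *)
Theorem steinberg_word x Q s : (0 < Q)%N -> steinberg x -> level1 x Q ->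
  wordg (x i j) (x j i) w4word = 1%g ->
  eqm1 Q (wordm s) -> wordg (x i j) (x j i) s = 1%g.
Proof.
elim/ltn_ind: Q x s => Q IH x s Q0 xP lQ w4 ms.
have [[[|k] Qk]|[p [k [m [pp op m0 co QE]]]]] := pow2_or_odd Q0.
- have x1 a b t : a != b -> x a b t = 1%g.
    by move=> ab; apply: (level1_dvd xP lQ ab); rewrite Qk.
  rewrite (eq_wordg (X' := fun=> 1%g) (Y' := fun=> 1%g)) => [|t|t]; rewrite ?x1 //.
  by rewrite /wordg; elim: s {ms} => //= -[b t] s IHs; rewrite if_same mulg1.
- by apply: (prime_power_word (p := 2) (k := k)); rewrite -?Qk.
have [u [v uv]] : exists u v : int, u * (p ^ k.+1)%N%:Z + v * m%:Z = 1.
  have /coprimezP [[u v] /= uv] : coprimez (p ^ k.+1)%N%:Z m%:Z by rewrite coprimezE.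
  by exists u, v.
set q := (p ^ k.+1)%N in uv QE co.
(* The idempotent is 1 modulo q and 0 modulo m, so x(e t) has level q and x((1 - e) t) has level
   m. *)
pose e := v * m%:Z.
have e1 : 1 - e = u * q%:Z by rewrite -uv /e addrK.
have eQ : (Q %| `|(e * e - e)%R|)%N.
  rewrite (_ : e * e - e = - ((1 - e) * e)); last by ring.
  rewrite e1 /e abszN !abszM !absz_nat QE; apply/dvdnP; exists (`|u| * `|v|)%N.
  by lia.
have q1 : (1 < q)%N by rewrite /q expnS; have := prime_gt1 pp; have := expn_gt0 p k; nia.
have odd_case r : eqm1 q (wordm r) -> wordg (fun t => x i j (e * t)) (fun t => x j i (e * t)) r = 1%g.
  move=> mr; apply: (@prime_power_word (fun a b t => x a b (e * t)) p k) => //.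
  - exact (steinberg_idem xP lQ eQ).
  - move=> a b ab; apply: (level1_dvd xP lQ ab).
    by rewrite /e !abszM !absz_nat QE -mulnA dvdn_mull // mulnC.
  - by move=> p2; rewrite p2 in op.
have qQ : (q %| Q)%N by rewrite QE dvdn_mulr.
rewrite (split_word xP lQ eQ) odd_case ?mul1g; last exact: eqm1_dvd ms.
apply: (IH m _ (fun a b t => x a b ((1 - e) * t))) => //.
- by rewrite QE -{1}[m]mul1n ltn_mul2r m0.
- exact (steinberg_idem xP lQ (eQN eQ)).
- move=> a b ab; apply: (level1_dvd xP lQ ab).
  by rewrite e1 !abszM !absz_nat QE -mulnA dvdn_mull.
(* The word w^4 has identity matrix, so its component over q is trivial by [odd_case]; its component
   over m is then trivial as well. *)
- by move: w4; rewrite (split_word xP lQ eQ) odd_case ?mul1g ?w4_wordm /= ?dvdn0.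
- by apply: eqm1_dvd ms; rewrite QE dvdn_mull.
Qed.

End IntWords.

(** * Quotient groups and the special linear group *)

Local Open Scope quotient_scope.

Record normal_subgroup (G : groupType) := NormalSubgroup {
  in_normal :> G -> Prop;
  normal1 : in_normal 1%g;
  normalM : forall g h, in_normal g -> in_normal h -> in_normal (g * h)%g;
  normalV : forall g, in_normal g -> in_normal (g^-1)%g;
  normalJ : forall g h, in_normal g -> in_normal (g ^ h)%g }.

Section Quotient.
Variables (G : groupType) (N : normal_subgroup G).
Let N1 := normal1 N.
Let NM := @normalM G N.
Let NV := @normalV G N.
Let NJ := @normalJ G N.

Definition cong_rel (g h : G) : bool := `[< N (g^-1 * h)%g >].

Lemma cong_relP : equiv_class_of cong_rel.
Proof.
split.
- by move=> g; rewrite /cong_rel mulVg; apply/asboolP.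
- by move=> g h; apply/asboolP/asboolP => /NV; rewrite invgM invgK.
- move=> h g k /asboolP gh /asboolP hk; apply/asboolP.
  by have := NM gh hk; rewrite mulgA mulgK.
Qed.

Canonical cong_equiv := EquivRelPack cong_relP.

Definition gquot := {eq_quot cong_equiv}.
HB.instance Definition _ := Choice.on gquot.

Definition gpi (g : G) : gquot := \pi_(gquot) g.
Definition gmul (a b : gquot) : gquot := gpi (repr a * repr b)%g.
Definition ginv (a : gquot) : gquot := gpi (repr a)^-1%g.

Lemma gpiP g h : gpi g = gpi h <-> N (g^-1 * h)%g.
Proof.
split; first by move/eqmodP => /asboolP.
by move=> H; apply/eqmodP/asboolP.
Qed.

Lemma gpi_repr a : gpi (repr a) = a.
Proof. exact: reprK. Qed.

Lemma gpiM g h : gpi (g * h)%g = gmul (gpi g) (gpi h).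
Proof.
apply/gpiP; have /gpiP H1 : gpi g = gpi (repr (gpi g)) by rewrite gpi_repr.
have /gpiP H2 : gpi h = gpi (repr (gpi h)) by rewrite gpi_repr.
move: (NM (NJ h H1) H2); congr (in_normal N _).
by rewrite conjgE invgM !mulgA mulgK.
Qed.

Lemma gpiV g : gpi g^-1%g = ginv (gpi g).
Proof.
apply/gpiP; have /gpiP H1 : gpi g = gpi (repr (gpi g)) by rewrite gpi_repr.
move: (NJ (repr (gpi g))^-1%g (NV H1)); congr (in_normal N _).
by rewrite conjgE invgM !invgK !mulgA mulgV mul1g.
Qed.

Lemma gquotA : associative gmul.
Proof.
by move=> a b c; rewrite -(gpi_repr a) -(gpi_repr b) -(gpi_repr c) -!gpiM mulgA.
Qed.
Lemma gquot1g : left_id (gpi 1%g) gmul.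
Proof. by move=> a; rewrite -(gpi_repr a) -gpiM mul1g. Qed.
Lemma gquotg1 : right_id (gpi 1%g) gmul.
Proof. by move=> a; rewrite -(gpi_repr a) -gpiM mulg1. Qed.
Lemma gquotVg : left_inverse (gpi 1%g) ginv gmul.
Proof. by move=> a; rewrite -(gpi_repr a) -gpiV -gpiM mulVg. Qed.
Lemma gquotgV : right_inverse (gpi 1%g) ginv gmul.
Proof. by move=> a; rewrite -(gpi_repr a) -gpiV -gpiM mulgV. Qed.

HB.instance Definition _ := isGroup.Build gquot gquotA gquot1g gquotg1 gquotVg gquotgV.

Lemma gpi_mul g h : gpi (g * h)%g = (gpi g * gpi h)%g.
Proof. exact: gpiM. Qed.

Lemma gpi_eq1 g : gpi g = 1%g <-> N g.
Proof.
rewrite -[1%g]/(gpi 1%g); split.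
  by move/gpiP => /NV; rewrite mulg1 invgK.
by move=> Ng; apply/gpiP; rewrite mulg1; apply: NV.
Qed.
End Quotient.

Section SL.
Variables (R : comUnitRingType) (n : nat).

Definition SL := {g : 'M[R]_n | \det g == 1}.
HB.instance Definition _ := Choice.on SL.
Implicit Types g h : SL.

Lemma SL_det g : \det (val g) = 1. Proof. by apply/eqP/(valP g). Qed.
Lemma SL_unit g : val g \in unitmx. Proof. by rewrite unitmxE SL_det unitr1. Qed.

Lemma SL_mulP g h : \det (val g *m val h) == 1.
Proof. by rewrite det_mulmx !SL_det mulr1. Qed.
Lemma SL_invP g : \det (invmx (val g)) == 1.
Proof. by rewrite det_inv SL_det invr1. Qed.
Lemma SL_1P : \det (1%:M : 'M[R]_n) == 1. Proof. by rewrite det1. Qed.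

Definition SL_mul g h : SL := exist (fun g : 'M[R]_n => \det g == 1) _ (SL_mulP g h).
Definition SL_inv g : SL := exist (fun g : 'M[R]_n => \det g == 1) _ (SL_invP g).
Definition SL_one : SL := exist (fun g : 'M[R]_n => \det g == 1) _ SL_1P.

Lemma SL_mulA : associative SL_mul.
Proof. by move=> a b c; apply: val_inj; rewrite /= mulmxA. Qed.
Lemma SL_mul1 : left_id SL_one SL_mul.
Proof. by move=> a; apply: val_inj; rewrite /= mul1mx. Qed.
Lemma SL_mul1r : right_id SL_one SL_mul.
Proof. by move=> a; apply: val_inj; rewrite /= mulmx1. Qed.
Lemma SL_mulV : left_inverse SL_one SL_inv SL_mul.
Proof. by move=> a; apply: val_inj; rewrite /= mulVmx // SL_unit. Qed.
Lemma SL_mulVr : right_inverse SL_one SL_inv SL_mul.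
Proof. by move=> a; apply: val_inj; rewrite /= mulmxV // SL_unit. Qed.

HB.instance Definition _ := isGroup.Build SL SL_mulA SL_mul1 SL_mul1r SL_mulV SL_mulVr.

Definition SLmx (g : SL) : 'M[R]_n := val g.
Lemma SLmxM g h : SLmx (g * h)%g = SLmx g *m SLmx h. Proof. by []. Qed.
Lemma SLmxV g : SLmx (g^-1)%g = invmx (SLmx g). Proof. by []. Qed.
Lemma SLmx_inj : injective SLmx. Proof. exact: val_inj. Qed.
Lemma SLmx_det g : \det (SLmx g) = 1. Proof. exact: SL_det. Qed.
End SL.

Local Close Scope quotient_scope.

(** * Elementary matrices *)

Section Elementary.
Variables (R : comUnitRingType) (n : nat).
Implicit Types (i j k l : 'I_n) (a b c : R) (A B : 'M[R]_n) (u : 'cV[R]_n) (s : 'rV[R]_n).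

Definition el i j a : 'M[R]_n := 1%:M + a *: delta_mx i j.

Lemma el0 i j : el i j 0 = 1%:M.
Proof. by rewrite /el scale0r addr0. Qed.

Lemma mul_el A i j a k l : (A *m el i j a) k l = A k l + A k i * a * (l == j)%:R.
Proof.
rewrite /el mulmxDr mulmx1 -scalemxAr !mxE; congr (_ + _).
rewrite (bigD1 i) //= big1 => [|m mi]; last by rewrite mxE (negPf mi) mulr0.
by rewrite mxE eqxx addr0 mulrCA mulrA.
Qed.

Lemma el_mul A i j a k l : (el i j a *m A) k l = A k l + (k == i)%:R * a * A j l.
Proof.
rewrite /el mulmxDl mul1mx -scalemxAl !mxE; congr (_ + _).
rewrite (bigD1 j) //= big1 => [|m mi]; last by rewrite mxE (negPf mi) andbF mul0r.
by rewrite mxE eqxx andbT addr0 mulrA [_ * a]mulrC.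
Qed.

Lemma elE i j a k l : el i j a k l = (k == l)%:R + (k == i)%:R * a * (j == l)%:R.
Proof. by rewrite -[el i j a]mulmx1 el_mul !mxE. Qed.

Lemma elD i j a b : i != j -> el i j (a + b) = el i j a *m el i j b.
Proof.
move=> ij; apply/matrixP => k l; rewrite mul_el !elE.
by rewrite (eq_sym j i) (negPf ij) mulr0 addr0 (eq_sym l j); ring.
Qed.

Lemma elR i j k a b : i != j -> j != k -> i != k ->
  el i j a *m el j k b = el j k b *m el i j a *m el i k (a * b).
Proof.
move=> ij jk ik; apply/matrixP => p q; rewrite !mul_el !elE.
rewrite ?(eq_sym k i) ?(eq_sym j i) ?(eq_sym k j) ?eqxx ?(negPf ik) ?(negPf ij) ?(negPf jk) ?(eq_sym q).
by rewrite ?mulr0n ?mulr1n; ring.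
Qed.

Lemma elC i j k l a b : i != j -> k != l -> i != l -> j != k ->
  el i j a *m el k l b = el k l b *m el i j a.
Proof.
move=> ij kl il jk; apply/matrixP => p q; rewrite !mul_el !elE.
rewrite ?(eq_sym k j) ?(eq_sym l i) ?(negPf jk) ?(negPf il) ?(eq_sym q).
by rewrite ?mulr0n ?mulr1n; ring.
Qed.

Lemma elN i j a : i != j -> el i j a *m el i j (- a) = 1%:M.
Proof. by move=> ij; rewrite -elD // subrr el0. Qed.

Lemma invmx_eq A B : A *m B = 1%:M -> invmx A = B.
Proof.
move=> AB; have [UA _] := mulmx1_unit AB.
by rewrite -[LHS]mulmx1 -AB mulKmx.
Qed.

Lemma invmx_el i j a : i != j -> invmx (el i j a) = el i j (- a).
Proof. by move=> ij; apply/invmx_eq/elN. Qed.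

Lemma trmx_el i j a : (el i j a)^T = el j i a.
Proof.
by apply/matrixP => p q; rewrite mxE !elE (eq_sym q p) (eq_sym q i) (eq_sym j p); ring.
Qed.

Lemma det_el i j a : i != j -> \det (el i j a) = 1.
Proof.
have H k l b : (l < k)%N -> \det (el k l b) = 1.
  move=> lk; rewrite det_trig; last first.
    apply/is_trig_mxP => p q pq; rewrite elE.
    have -> : (p == q) = false by apply/negbTE; rewrite -val_eqE /= neq_ltn pq.
    case: (eqVneq p k) => [pk|]; last by rewrite !mul0r addr0.
    have -> : (l == q) = false by apply/negbTE; rewrite -val_eqE /=; subst p; lia.
    by rewrite mulr0 addr0.
  apply: big1 => p _; rewrite elE eqxx; case: (eqVneq p k) => [->|]; last by rewrite !mul0r addr0.
  have -> : (l == k) = false by apply/negbTE; rewrite -val_eqE /=; lia.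
  by rewrite mulr0 addr0.
move=> ij; have : (j < i)%N || (i < j)%N.
  by move: ij; rewrite -val_eqE /= neq_ltn orbC.
case/orP; first exact: H.
by move=> lij; rewrite -det_tr trmx_el H.
Qed.

Lemma el_unit i j a : i != j -> el i j a \in unitmx.
Proof. by move=> ij; rewrite unitmxE det_el // unitr1. Qed.

(** * Transvections in a multiplicatively closed set *)

Section Closure.
Variables (S : 'M[R]_n -> Prop) (a : R).
Hypotheses (S1 : S 1%:M) (SM : forall A B, S A -> S B -> S (A *m B)).
Hypothesis Sel : forall i j b, i != j -> S (el i j (a * b)).

(** As s vanishes at i, the factors el i j (a s_j) multiply by adding their off-diagonal parts. [S]
    is left abstract to serve both for the normal closure and for the groups of a subnormal
    series. *)
Lemma closure_row i s : s 0 i = 0 -> S (1%:M + delta_mx i 0 *m (a *: s)).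
Proof.
move=> si; rewrite [s]row_sum_delta scaler_sumr.
pose P (t : 'rV[R]_n) := S (1%:M + delta_mx i 0 *m t) /\ t 0 i = 0.
suff : P (\sum_(j < n) a *: (s 0 j *: delta_mx 0 j)) by case.
apply: (big_ind P); first by split; rewrite ?mulmx0 ?addr0 ?mxE.
- move=> t t' [St ti] [St' ti']; split; last by rewrite mxE ti ti' addr0.
  have -> : 1%:M + delta_mx i 0 *m (t + t') =
      (1%:M + delta_mx i 0 *m t) *m (1%:M + delta_mx i 0 *m t') :> 'M_n.
    rewrite mulmxDl mul1mx mulmxDr mulmx1 mulmxDr -!addrA; congr (_ + _).
    rewrite [RHS]addrCA; congr (_ + _).
    rewrite mulmxA -[_ *m t *m _]mulmxA (_ : t *m delta_mx i 0 = 0) ?mulmx0 ?mul0mx ?addr0 //.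
    by apply/matrixP => p q; rewrite -colE !mxE !ord1.
  exact: SM.
- move=> j _; case: (eqVneq j i) => [->|ji].
    by rewrite si scale0r scaler0; split; rewrite ?mulmx0 ?addr0 ?mxE.
  split; last by rewrite !mxE (eq_sym i j) (negPf ji) andbF !mulr0.
  rewrite scalerA -scalemxAr mul_delta_mx; apply: Sel; by rewrite eq_sym.
Qed.

End Closure.

Section Closure2.
Variables (S : 'M[R]_n -> Prop) (a : R).
Hypotheses (S1 : S 1%:M) (SM : forall A B, S A -> S B -> S (A *m B)).
Hypothesis Sel : forall i j b, i != j -> S (el i j (a * b)).

Lemma closure_col j u : u j 0 = 0 -> S (1%:M + (a *: u) *m delta_mx 0 j).
Proof.
move=> uj; pose S' A := S (A^T).
have S'1 : S' 1%:M by rewrite /S' trmx1.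
have S'M A B : S' A -> S' B -> S' (A *m B).
  by rewrite /S' trmx_mul => SA SB; apply: SM.
have S'el i k b : i != k -> S' (el i k (a * b)).
  by move=> ik; rewrite /S' trmx_el; apply: Sel; rewrite eq_sym.
have := closure_row S'1 S'M S'el (i := j) (s := u^T).
rewrite mxE uj => /(_ erefl).
by rewrite /S' linearD /= trmx1 trmx_mul trmx_delta linearZ /= trmxK.
Qed.

Lemma comm4 (P Q : 'M[R]_n) : P *m P = 0 -> Q *m Q = 0 -> Q *m P = 0 ->
  (1%:M + P) *m (1%:M + Q) *m (1%:M - P) *m (1%:M - Q) = 1%:M + P *m Q.
Proof.
move=> PP QQ QP.
have -> : (1%:M + P) *m (1%:M + Q) *m (1%:M - P) = 1%:M + Q + P *m Q.
  rewrite -mulmxA; have -> : (1%:M + Q) *m (1%:M - P) = 1%:M + Q - P.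
    by rewrite mulmxBr mulmx1 mulmxDl mul1mx QP addr0.
  rewrite mulmxDl mul1mx (_ : P *m (1%:M + Q - P) = P + P *m Q) ?addrA ?subrK //.
  by rewrite mulmxBr mulmxDr mulmx1 PP subr0.
rewrite mulmxBr mulmx1 !mulmxDl mul1mx QQ -mulmxA QQ mulmx0 !addr0.
by rewrite addrAC addrK.
Qed.

Lemma rank1_mul z (u v : 'cV[R]_n) (s t : 'rV[R]_n) : s *m v = 0 ->
  (1%:M + z *: (u *m s)) *m (1%:M + z *: (v *m t)) = 1%:M + z *: (u *m s) + z *: (v *m t).
Proof.
move=> sv; rewrite mulmxDr mulmx1 mulmxDl mul1mx -scalemxAl -scalemxAr.
by rewrite -mulmxA (mulmxA s) sv mul0mx mulmx0 !scaler0 addr0.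
Qed.

Hypothesis n2 : (2 < n)%N.

Lemma third_index i j : exists2 k : 'I_n, j != k & i != k.
Proof.
have : (0 < #|~: [set i; j]|)%N.
  by rewrite cardsCs finset.setCK card_ord cards2; case: (i != j) => /=; lia.
case/card_gt0P => k; rewrite !inE negb_or => /andP[ki kj].
by exists k; rewrite eq_sym.
Qed.

(* The part u' of u supported on k and l is orthogonal to t, and so is u'';
   1 + (a a c) u' t is the commutator of 1 + a u' e_m and 1 + a c e_m^T t for a
   third index m. *)
Lemma closure_tau c u k l : k != l ->
  S (1%:M + (a * a * c) *: (u *m (u k 0 *: delta_mx 0 l - u l 0 *: delta_mx 0 k))).
Proof.
move=> kl; set t := _ - _; have [m lm km] := third_index k l.
have tE p : t 0 p = u k 0 * (p == l)%:R - u l 0 * (p == k)%:R by rewrite !mxE.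
have tmul (v : 'cV_n) : t *m v = (u k 0 * v l 0 - u l 0 * v k 0)%:M.
  rewrite mulmxBl -!scalemxAl -!rowE; apply/matrixP => p q.
  by rewrite !mxE !ord1 eqxx mulr1n.
pose u' : 'cV_n := u k 0 *: delta_mx k 0 + u l 0 *: delta_mx l 0.
have u'E p : u' p 0 = u k 0 * (p == k)%:R + u l 0 * (p == l)%:R by rewrite !mxE !andbT.
pose u'' := u - u'.
have tu' : t *m u' = 0.
  rewrite tmul !u'E !eqxx (eq_sym l k) (negPf kl) /=; apply/matrixP => p q.
  by rewrite !mxE; rewrite (_ : _ - _ = 0) ?mul0rn //; ring.
rewrite (_ : u = u'' + u'); last by rewrite subrK.
rewrite mulmxDl scalerDr addrA -rank1_mul //; apply: SM.
  rewrite [u'']matrix_sum_delta; under eq_bigr do rewrite big_ord1.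
  pose P (v : 'cV[R]_n) := S (1%:M + (a * a * c) *: (v *m t)) /\ t *m v = 0.
  suff : P (\sum_i u'' i ord0 *: delta_mx i ord0) by case.
  apply: (big_ind P); first by split; rewrite ?mul0mx ?mulmx0 ?scaler0 ?addr0.
    move=> v v' [Sv tv] [Sv' tv']; split; last by rewrite mulmxDr tv tv' addr0.
    by rewrite mulmxDl scalerDr addrA -rank1_mul //; apply: SM.
  move=> p _; have uE : u'' p 0 = u p 0 - u' p 0 by rewrite !mxE.
  have [pk|pk] := eqVneq p k.
    rewrite uE u'E pk eqxx (negPf kl) mulr1 mulr0 addr0 subrr scale0r.
    by split; rewrite ?mul0mx ?mulmx0 ?scaler0 ?addr0.
  have [pl|pl] := eqVneq p l.
    rewrite uE u'E pl eqxx (eq_sym l k) (negPf kl) mulr1 mulr0 add0r subrr scale0r.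
    by split; rewrite ?mul0mx ?mulmx0 ?scaler0 ?addr0.
  split; last first.
    rewrite tmul !mxE (eq_sym l p) (eq_sym k p) (negPf pl) (negPf pk) /= !mulr0 subr0.
    by apply/matrixP => i j; rewrite !mxE mul0rn.
  have -> : (a * a * c) *: (u'' p ord0 *: delta_mx p ord0 *m t) =
      delta_mx p 0 *m (a *: ((a * c * u'' p 0) *: t)).
    by rewrite -scalemxAl -!scalemxAr !scalerA; congr (_ *: _); ring.
  by apply: (closure_row S1 SM Sel); rewrite mxE tE (negPf pk) (negPf pl) !mulr0 subr0 mulr0.
pose Pm : 'M[R]_n := (a *: u') *m delta_mx 0 m; pose Qm : 'M[R]_n := delta_mx m 0 *m (a *: (c *: t)).
have um : u' m 0 = 0 by rewrite u'E (eq_sym m k) (eq_sym m l) (negPf lm) (negPf km) !mulr0 addr0.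
have tm : t 0 m = 0 by rewrite tE (eq_sym m k) (eq_sym m l) (negPf lm) (negPf km) !mulr0 subr0.
have dd : (delta_mx 0 m : 'rV[R]_n) *m (delta_mx m 0 : 'cV[R]_n) = 1%:M.
  by rewrite mul_delta_mx; apply/matrixP => p q; rewrite !mxE !ord1.
have du : (delta_mx 0 m : 'rV[R]_n) *m u' = 0.
  by rewrite -rowE; apply/matrixP => p q; rewrite !mxE !ord1 -[RHS]um !mxE.
have td : t *m (delta_mx m 0 : 'cV[R]_n) = 0.
  by rewrite -colE; apply/matrixP => p q; rewrite !mxE !ord1 -[RHS]tm !mxE.
have PP : Pm *m Pm = 0.
  by rewrite /Pm mulmxA -(mulmxA _ (delta_mx 0 m)) -scalemxAr du scaler0 mulmx0 mul0mx.
have QQ : Qm *m Qm = 0.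
  by rewrite /Qm -mulmxA (mulmxA (a *: _)) -!scalemxAl td mul0mx !scaler0 mulmx0.
have QP : Qm *m Pm = 0.
  have tau' : t *m (a *: u') = 0 by rewrite -scalemxAr tu' scaler0.
  by rewrite /Qm /Pm -mulmxA (mulmxA (a *: (c *: t))) -!scalemxAl tau' mul0mx !scaler0 mulmx0.
rewrite (_ : _ *: (u' *m t) = Pm *m Qm); last first.
  rewrite /Pm /Qm -mulmxA (mulmxA (delta_mx 0 m)) dd mul1mx -!scalemxAl -!scalemxAr !scalerA.
  by congr (_ *: _); ring.
rewrite -comm4 //.
have SP : S (1%:M + Pm) by apply: closure_col.
have SQ : S (1%:M + Qm) by apply: (closure_row S1 SM Sel); rewrite mxE tm mulr0.
have SP' : S (1%:M - Pm).
  by rewrite /Pm -mulNmx -scalerN; apply: closure_col; rewrite mxE um oppr0.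
have SQ' : S (1%:M - Qm).
  by rewrite /Qm -mulmxN -!scalerN; apply: (closure_row S1 SM Sel); rewrite mxE [(- t) 0 m]mxE tm oppr0 mulr0.
by do !apply: SM.
Qed.

(* Suslin: g el(a a c) g^-1 = 1 + a a c u s with s u = 0 and u unimodular, and
   such an s is a combination of the Koszul relations tau k l. *)
Lemma closure_conj c g i j : i != j -> g \in unitmx ->
  S (g *m el i j (a * a * c) *m invmx g).
Proof.
move=> ij Ug.
have -> : g *m el i j (a * a * c) *m invmx g = 1%:M + (a * a * c) *: (col i g *m row j (invmx g)).
  rewrite /el mulmxDr mulmx1 mulmxDl mulmxV //; congr (_ + _).
  rewrite -scalemxAr -scalemxAl; congr (_ *: _).
  by rewrite -(mul_delta_mx (0 : 'I_1)) mulmxA -colE -mulmxA -rowE.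
set u := col i g; set s := row j (invmx g); pose r := row i (invmx g).
have su : s *m u = 0.
  apply/matrixP => p q; rewrite !ord1 !mxE.
  have := mulVmx Ug => /matrixP/(_ j i); rewrite !mxE (eq_sym j i) (negPf ij) mulr0n.
  by apply: etrans; apply: eq_bigr => m _; rewrite !mxE.
have ru : r *m u = 1%:M.
  rewrite /r /u; apply/matrixP => p q; rewrite !ord1.
  have := mulVmx Ug => /matrixP/(_ i i); rewrite !mxE !eqxx.
  by apply: etrans; apply: eq_bigr => m _; rewrite !mxE.
pose tau k l : 'rV[R]_n := u k 0 *: delta_mx 0 l - u l 0 *: delta_mx 0 k.
have tu k l : tau k l *m u = 0.
  rewrite mulmxBl -!scalemxAl -!rowE; apply/matrixP => p q.
  by rewrite [q]ord1 !mxE; ring.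
(* With these coefficients the double sum equals (r u) s - (s u) r, which is s because r u = 1 and s
   u = 0. *)
have sE : s = \sum_k \sum_l (s 0 l * r 0 k) *: tau k l.
  have r1 : \sum_k r 0 k * u k 0 = 1.
    by move/matrixP: ru => /(_ 0 0); rewrite !mxE eqxx.
  have s0 : \sum_l s 0 l * u l 0 = 0.
    by move/matrixP: su => /(_ 0 0); rewrite !mxE.
  apply/rowP => q; rewrite summxE.
  have delta (F : 'I_n -> R) : \sum_l F l * (q == l)%:R = F q.
    rewrite (bigD1 q) //= eqxx mulr1 big1 ?addr0 // => l lq.
    by rewrite eq_sym (negPf lq) mulr0.
  transitivity (\sum_k (s 0 q * (r 0 k * u k 0) - \sum_l (s 0 l * u l 0) * (r 0 k * (q == k)%:R))).
    rewrite sumrB -mulr_sumr r1 mulr1; under eq_bigr do rewrite -mulr_suml s0 mul0r.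
    by rewrite big1 // subr0.
  apply: eq_bigr => k _; rewrite summxE.
  under [RHS]eq_bigr do rewrite !mxE /= mulrBr.
  rewrite sumrB; congr (_ - _); last by apply: eq_bigr => l _; rewrite !mxE; ring.
  rewrite -[LHS](delta (fun l => s 0 l * (r 0 k * u k 0))).
  by apply: eq_bigr => l _; rewrite !mxE; ring.
rewrite sE.
pose P (t : 'rV[R]_n) := S (1%:M + (a * a * c) *: (u *m t)) /\ t *m u = 0.
suff : P (\sum_k \sum_l (s 0 l * r 0 k) *: tau k l) by case.
have P0 : P 0 by split; rewrite ?mulmx0 ?mul0mx ?scaler0 ?addr0.
have PD t t' : P t -> P t' -> P (t + t').
  move=> [St tt] [St' tt']; split; last by rewrite mulmxDl tt tt' addr0.
  by rewrite mulmxDr scalerDr addrA -rank1_mul //; apply: SM.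
apply: (big_ind P) => // k _; apply: (big_ind P) => // l _.
have [<-|kl] := eqVneq k l; first by rewrite /tau subrr scaler0.
split; last by rewrite -scalemxAl tu scaler0.
by rewrite -scalemxAr scalerA -mulrA; apply: closure_tau.
Qed.

End Closure2.
End Elementary.

(** * The congruence subgroup property *)

Section NormalClosure.
Variables (R : comUnitRingType) (n : nat).
Implicit Types (i j k l : 'I_n) (a b c q : R) (A B g s : 'M[R]_n).

(* The normal closure in SL_n of the elementary matrices of level q. *)
Inductive normE q : 'M[R]_n -> Prop :=
| normE1 : normE q 1%:M
| normEM A B of normE q A & normE q B : normE q (A *m B)
| normEJ s i j b of \det s = 1 & i != j : normE q (s *m el i j (q * b) *m invmx s).

Lemma det1_unit s : \det s = 1 -> s \in unitmx.
Proof. by move=> s1; rewrite unitmxE s1 unitr1. Qed.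

Lemma invmxM A B : A \in unitmx -> B \in unitmx -> invmx (A *m B) = invmx B *m invmx A.
Proof.
by move=> UA UB; apply: invmx_eq; rewrite -mulmxA mulKVmx // mulmxV.
Qed.

Lemma normE_el q i j b : i != j -> normE q (el i j (q * b)).
Proof.
move=> ij; have := @normEJ q 1%:M i j b (det1 _ _) ij.
by rewrite invmx1 mul1mx mulmx1.
Qed.

Lemma normE_det q A : normE q A -> \det A = 1.
Proof.
elim=> [|B C _ B1 _ C1|s i j b s1 ij]; first by rewrite det1.
  by rewrite det_mulmx B1 C1 mulr1.
by rewrite !det_mulmx det_inv s1 invr1 mulr1 mul1r det_el.
Qed.

Lemma normE_conj q s A : \det s = 1 -> normE q A -> normE q (s *m A *m invmx s).
Proof.
move=> s1; have Us := det1_unit s1.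
elim=> [|B C _ IB _ IC|t i j b t1 ij].
- by rewrite mulmx1 mulmxV //; apply: normE1.
- have -> : s *m (B *m C) *m invmx s = (s *m B *m invmx s) *m (s *m C *m invmx s).
    by rewrite !mulmxA mulmxKV.
  exact: normEM.
- have -> : s *m (t *m el i j (q * b) *m invmx t) *m invmx s =
     (s *m t) *m el i j (q * b) *m invmx (s *m t).
    by rewrite invmxM ?det1_unit // !mulmxA.
  by apply: normEJ; rewrite ?det_mulmx ?s1 ?t1 ?mulr1.
Qed.

Lemma normE_inv q A : normE q A -> normE q (invmx A).
Proof.
elim=> [|B C NB IB NC IC|t i j b t1 ij].
- by rewrite invmx1; apply: normE1.
- by rewrite invmxM ?det1_unit ?(normE_det NB) ?(normE_det NC) //; apply: normEM.
- have Ut := det1_unit t1.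
  rewrite (_ : invmx _ = t *m el i j (q * - b) *m invmx t); first exact: normEJ.
  apply: invmx_eq; rewrite !mulmxA mulmxKV // -(mulmxA t) mulrN elN //.
  by rewrite mulmx1 mulmxV.
Qed.

Lemma normE_conjV q s A : \det s = 1 -> normE q (s *m A *m invmx s) -> normE q A.
Proof.
move=> s1 H; have Us := det1_unit s1.
have s1' : \det (invmx s) = 1 by rewrite det_inv s1 invr1.
have := normE_conj s1' H; rewrite invmxK !mulmxA mulVmx // mul1mx mulmxKV //.
Qed.

Lemma normE_cancell q A B : normE q A -> normE q (A *m B) -> normE q B.
Proof.
move=> NA NAB; have UA := det1_unit (normE_det NA).
by rewrite -(mulKmx UA B); apply: normEM => //; apply: normE_inv.
Qed.

Lemma normE_cancelr q A B : normE q B -> normE q (A *m B) -> normE q A.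
Proof.
move=> NB NAB; have UB := det1_unit (normE_det NB).
by rewrite -(mulmxK UB A); apply: normEM => //; apply: normE_inv.
Qed.

Definition cong q g := exists A, g = 1%:M + q *: A.

Lemma congM q g h : cong q g -> cong q h -> cong q (g *m h).
Proof.
move=> [A ->] [B ->]; exists (A + B + q *: (A *m B)).
rewrite mulmxDl mul1mx mulmxDr mulmx1 !scalerDr -scalemxAl -scalemxAr.
by rewrite -!addrA; congr (_ + _); rewrite addrCA.
Qed.

Lemma cong_conj q g s : s \in unitmx -> cong q g -> cong q (s *m g *m invmx s).
Proof.
move=> Us [A ->]; exists (s *m A *m invmx s).
by rewrite mulmxDr mulmx1 mulmxDl mulmxV // -scalemxAr -scalemxAl.
Qed.

Lemma normE_cong q g : normE q g -> cong q g.
Proof.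
elim=> [|B C _ IB _ IC|t i j b t1 ij]; first by exists 0; rewrite scaler0 addr0.
  exact: congM.
apply: cong_conj; first exact: det1_unit.
by exists (b *: delta_mx i j); rewrite scalerA.
Qed.

(* g is the identity matrix outside its upper left m x m block. *)
Definition idout m g := forall i j, (m <= i)%N || (m <= j)%N -> g i j = (i == j)%:R.

Lemma sum_deltal (F : 'I_n -> R) i : \sum_k (i == k)%:R * F k = F i.
Proof.
rewrite (bigD1 i) //= eqxx mul1r big1 ?addr0 // => k ki.
by rewrite eq_sym (negPf ki) mul0r.
Qed.

Lemma sum_deltar (F : 'I_n -> R) i : \sum_k F k * (k == i)%:R = F i.
Proof.
by under eq_bigr do rewrite mulrC eq_sym; apply: sum_deltal.
Qed.

Lemma idoutM m g h : idout m g -> idout m h -> idout m (g *m h).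
Proof.
move=> Ig Ih i j /orP[mi|mj]; rewrite mxE.
  under eq_bigr do rewrite Ig ?mi //.
  by rewrite sum_deltal Ih // mi.
under eq_bigr => k _ do rewrite (Ih k j) ?mj ?orbT //.
by rewrite sum_deltar Ig // mj orbT.
Qed.

Lemma idout_el m i j a : (i < m)%N -> (j < m)%N -> idout m (el i j a).
Proof.
move=> im jm k l kl; rewrite elE.
case: (eqVneq k i) => [ki|]; last by rewrite !mul0r addr0.
case: (eqVneq j l) => [jl|]; last by rewrite mulr0 addr0.
by move: kl; rewrite ki -jl (leqNgt m i) (leqNgt m j) im jm.
Qed.

Definition emb i j (M : R * R * R * R) : 'M[R]_n :=
  let: (a, b, c, d) := M in
  \matrix_(k, l) (if k == i then (if l == i then a else if l == j then b else 0)
    else if k == j then (if l == i then c else if l == j then d else 0)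
    else (k == l)%:R).

Lemma emb_stepX i j M t : i != j -> emb i j M *m el i j t = emb i j (mstep M (true, t)).
Proof.
move=> ij; move: M => [[[a b] c] d]; apply/matrixP => k l; rewrite mul_el !mxE eqxx.
have [ki|ki] := eqVneq k i.
  have [->|li] := eqVneq l i; first by rewrite ?(negPf ij) mulr0 addr0.
  by case: (eqVneq l j) => [?|?]; rewrite ?mulr1 ?mulr0 ?addr0.
have [kj|kj] := eqVneq k j.
  have [->|li] := eqVneq l i; first by rewrite ?(negPf ij) mulr0 addr0.
  by case: (eqVneq l j) => [?|?]; rewrite ?mulr1 ?mulr0 ?addr0.
by rewrite !mul0r addr0.
Qed.

Lemma emb_stepY i j M t : i != j -> emb i j M *m el j i t = emb i j (mstep M (false, t)).
Proof.
move=> ij; have ji : j != i by rewrite eq_sym.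
move: M => [[[a b] c] d]; apply/matrixP => k l; rewrite mul_el !mxE eqxx (negPf ji).
have [ki|ki] := eqVneq k i.
  by case: (eqVneq l i) => [?|?]; rewrite ?mulr1 ?mulr0 ?addr0.
have [kj|kj] := eqVneq k j.
  by case: (eqVneq l i) => [?|?]; rewrite ?mulr1 ?mulr0 ?addr0.
by rewrite !mul0r addr0.
Qed.

Lemma emb1 i j : i != j -> emb i j (1, 0, 0, 1) = 1%:M.
Proof.
move=> ij; apply/matrixP => k l; rewrite !mxE.
have [->|ki] := eqVneq k i.
  by rewrite (eq_sym i l); case: (l == i) => //; case: (l == j).
have [->|kj] := eqVneq k j => //; rewrite (eq_sym j l).
have [->|li] := eqVneq l i; first by rewrite (negPf ij).
by case: (l == j).
Qed.

End NormalClosure.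
Arguments emb : simpl never.

(** * Matrices of determinant one as words *)

Section EuclideanWords.
Variables (R : comUnitRingType) (N : R -> nat).
Hypothesis euclid : forall a b : R, b != 0 -> exists c, (N (a - c * b) < N b)%N.

Lemma word_back (M : R * R * R * R) p s : wordm s = mstep M p -> exists s', wordm s' = M.
Proof.
move=> E; exists (rcons s (p.1, - p.2)); rewrite /wordm foldl_rcons -/(wordm s) E.
by case: M {E} => [[[a b] c] d]; case: p => [[] t] /=; congr (_, _, _, _); ring.
Qed.

Lemma euclid_word (a b c d : R) : a * d - b * c = 1 -> exists s, wordm s = (a, b, c, d).
Proof.
have base0 (a' b' d' : R) : a' * d' = 1 -> exists s, wordm s = (a', b', 0, d').
  move=> E.
  (* The diagonal may carry any unit, not only 1 or -1. Since d' a' = 1, the first letter creates a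
     1 in the lower left corner, the second a 1 in the lower right, the third clears the lower left,
     and the fourth the upper right. *)
  suff [s5 E5] : exists s, wordm s = mstep (mstep (mstep (mstep (a', b', 0, d')
      (false, a')) (true, 1 - d')) (false, -1)) (true, - (b' + (a' + b' * a') * (1 - d'))).
    by have [? /word_back[? /word_back[? /word_back]]] := word_back E5.
  exists [::]; rewrite /= /wordm /=; congr (_, _, _, _).
  all: try by ring: E.
move: {2}(N c).+1 (ltnSn (N c)) => m; elim: m a b c d => // m IH a b c d cm det.
have [c0|c0] := eqVneq c 0.
  by rewrite c0; apply: base0; rewrite -det c0; ring.
have [q rc] := euclid d c0; set r := d - q * c in rc.
have [r0|r0] := eqVneq r 0.
  (* The lower right entry is now 0 and c is a unit with inverse -b1: the letter -b1 makes the lower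
     right entry 1, and -c then clears the lower left. *)
  pose b1 := b - a * q.
  have E1 : b1 * c = -1.
    have dE : d = q * c by apply/eqP; rewrite -subr_eq0 -/r r0.
    by transitivity (- (a * d - b * c)); [rewrite dE /b1; ring | rewrite det].
  have [|s3 E3] := @base0 (a + (b1 - a * b1) * - c) (b1 - a * b1) 1.
    by ring: E1.
  suff E : wordm s3 = mstep (mstep (mstep (a, b, c, d) (true, - q)) (true, - b1)) (false, - c).
    by have [? /word_back[? /word_back]] := word_back E.
  rewrite E3 /=; have dE : d + c * - q = 0 by rewrite -[RHS]r0 /r; ring.
  have bE : b + a * - q = b1 by rewrite /b1; ring.
  by rewrite dE bE; congr (_, _, _, _); ring: E1.
have [q' rc'] := euclid c r0.
pose a1 := a + (b + a * - q) * - q'.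
have [||s2 E2] := IH a1 (b + a * - q) (c - q' * r) r.
- by move: cm rc rc'; set x := N c; set y := N r; set z := N _; lia.
- by rewrite -det /a1 /r; ring.
suff E : wordm s2 = mstep (mstep (a, b, c, d) (true, - q)) (false, - q').
  by have [? /word_back] := word_back E.
by rewrite E2 /=; congr (_, _, _, _); rewrite /a1 /r; ring.
Qed.

End EuclideanWords.

Lemma block2_emb (R : comUnitRingType) n (i0 i1 : 'I_n) (g : 'M[R]_n) : i0 = 0%N :> nat -> i1 = 1%N :> nat -> idout 2 g ->
  g = emb i0 i1 (g i0 i0, g i0 i1, g i1 i0, g i1 i1).
Proof.
move=> i00 i11 Ig; apply/matrixP => k l; rewrite mxE.
have C (m : 'I_n) : [\/ m = i0, m = i1 | (2 <= m)%N].
  case: (ltnP m 2) => m2; last by constructor 3.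
  have [m0|m0] := eqVneq (m : nat) 0%N; first by constructor 1; apply: val_inj; rewrite /= m0 i00.
  by constructor 2; apply: val_inj; rewrite /= i11; lia.
have N0 (m : 'I_n) : (2 <= m)%N -> (m == i0) = false /\ (m == i1) = false.
  by move=> m2; split; apply/negbTE; rewrite -val_eqE /= ?i00 ?i11; lia.
have i10 : (i1 == i0) = false by apply/negbTE; rewrite -val_eqE /= i00 i11.
case: (C k) => [->|->|k2]; rewrite ?eqxx ?i10.
- case: (C l) => [->|->|l2]; rewrite ?eqxx ?i10 //.
  by have [l0 l1] := N0 _ l2; rewrite l0 l1 Ig ?l2 ?orbT // eq_sym l0.
- case: (C l) => [->|->|l2]; rewrite ?eqxx ?i10 //.
  by have [l0 l1] := N0 _ l2; rewrite l0 l1 Ig ?l2 ?orbT // eq_sym l1.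
by have [-> ->] := N0 _ k2; rewrite Ig ?k2.
Qed.

(** * Blocks of size two *)

Section BaseCase.
Variables (R : comUnitRingType) (n : nat) (q : R) (Q : nat).
Hypothesis n2 : (2 < n)%N.
Hypothesis int_surj : forall a : R, exists t : int, t%:~R = a.
Variable N : R -> nat.
Hypothesis euclid : forall a b : R, b != 0 -> exists c, (N (a - c * b) < N b)%N.
Hypothesis Q0 : (0 < Q)%N.
Hypothesis Qq : exists c, Q%:R = q * c.
Hypothesis qQ : forall (t : int) b, t%:~R = q * b -> (Q %| `|t|)%N.

Definition normE_sub_pred (g : SL R n) : Prop := normE q (SLmx g).

Lemma normE_sub_conj (g h : SL R n) : normE_sub_pred g -> normE_sub_pred (g ^ h)%g.
Proof.
move=> Ng; have h1 : \det (invmx (SLmx h)) = 1 by rewrite det_inv SLmx_det invr1.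
by have := normE_conj h1 Ng; rewrite invmxK -mulmxA -SLmxV -!SLmxM.
Qed.

Definition normE_sub : normal_subgroup (SL R n) :=
  @NormalSubgroup (SL R n) normE_sub_pred (normE1 _ _) (fun g h => @normEM _ _ q _ _)
    (fun g => @normE_inv _ _ q _) normE_sub_conj.

(** The default [1%g] can be reached only for i = j, where the determinant may differ from 1. *)
Definition SLel (i j : 'I_n) (t : int) : SL R n := insubd (1%g : SL R n) (el i j t%:~R).

Lemma val_SLel i j t : i != j -> SLmx (SLel i j t) = el i j t%:~R.
Proof. by move=> ij; rewrite /SLmx /SLel val_insubd det_el // eqxx. Qed.

Definition xq i j t : gquot normE_sub := gpi normE_sub (SLel i j t).

Lemma steinberg_xq : steinberg xq.
Proof.
split.
- move=> i j a b ij; rewrite /xq -gpi_mul; congr gpi; apply: SLmx_inj.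
  by rewrite !SLmxM !val_SLel // intrD elD.
- move=> i j k a b ij jk ik; rewrite /xq -(gpi_mul _ (SLel j k b)) -!gpi_mul; congr gpi; apply: SLmx_inj.
  by rewrite !SLmxM !val_SLel // intrM elR.
- move=> i j k l a b ij kl il jk; rewrite /commute /xq -!gpi_mul; congr gpi.
  by apply: SLmx_inj; rewrite !SLmxM !val_SLel // elC.
Qed.

Lemma level1_xq : level1 xq Q.
Proof.
move=> i j ij; apply/gpi_eq1; rewrite /= /normE_sub_pred val_SLel // -pmulrn.
by have [c ->] := Qq; apply: normE_el.
Qed.

Lemma SL_wordg i j s : i != j ->
  SLmx (wordg (SLel i j) (SLel j i) s) = emb i j (wordm (wmap intr s)).
Proof.
move=> ij; have ji : j != i by rewrite eq_sym.
rewrite /wordg /wordm.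
have : SLmx (1%g : SL R n) = emb i j (1, 0, 0, 1) by rewrite emb1.
elim: s (1%g : SL R n) (1, 0, 0, 1) => //= -[b t] s IH g M gM; apply: IH.
case: b; rewrite SLmxM val_SLel // gM.
  by rewrite emb_stepX.
by rewrite emb_stepY.
Qed.

Lemma gpi_wordg i j s :
  wordg (xq i j) (xq j i) s = gpi normE_sub (wordg (SLel i j) (SLel j i) s).
Proof.
rewrite /wordg -[X in foldl _ X _ = _]/(gpi normE_sub 1%g).
elim: s (1%g : SL R n) => //= -[b t] s IH g; rewrite -IH gpi_mul.
by case: b.
Qed.

(** The Euclidean word is lifted letter by letter to Z. By [qQ] its integer matrix is the identity
    modulo Q, so the word is trivial in the quotient by the normal closure. *)
Lemma normE_emb (i j : 'I_n) a b c d : i != j -> a * d - b * c = 1 ->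
  (exists a', a - 1 = q * a') -> (exists b', b = q * b') -> (exists c', c = q * c') ->
  (exists d', d - 1 = q * d') -> normE q (emb i j (a, b, c, d)).
Proof.
move=> ij det [a' qa] [b' qb] [c' qc] [d' qd].
have [s0 s0E] := euclid_word euclid det.
have [s sE] : exists s : seq (bool * int), s0 = wmap intr s.
  elim: s0 {s0E} => [|[e t] s0 [s ->]]; first by exists [::].
  by have [u <-] := int_surj t; exists ((e, u) :: s).
have [l jl il] := third_index n2 i j.
have third (u v : 'I_n) : u != v -> exists2 k, v != k & u != k.
  by move=> _; apply: third_index.
have : wordg (xq i j) (xq j i) s = 1%g.
  apply: (steinberg_word third ij jl il Q0 steinberg_xq level1_xq).
    rewrite gpi_wordg; apply/gpi_eq1; rewrite /= /normE_sub_pred SL_wordg //.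
    by rewrite wordm_map w4_wordm /= mulr1z mulr0z emb1 //; apply: normE1.
  move: s0E; rewrite sE wordm_map; case: (wordm s) => [[[a0 b0] c0] d0] /= [Ea Eb Ec Ed].
  apply/and4P; split.
  - by apply: (qQ (b := a')); rewrite intrB Ea.
  - by apply: (qQ (b := b')); rewrite Eb.
  - by apply: (qQ (b := c')); rewrite Ec.
  - by apply: (qQ (b := d')); rewrite intrB Ed.
rewrite gpi_wordg => /gpi_eq1; rewrite /= /normE_sub_pred SL_wordg //.
by rewrite -sE s0E.
Qed.

End BaseCase.

Lemma det_idout2 (R : comUnitRingType) n (g : 'M[R]_n.+2) : idout 2 g ->
  \det g = g 0 0 * g 1 1 - g 0 1 * g 1 0.
Proof.
move=> Ig.
have gE : g = block_mx (ulsubmx (g : 'M_(2 + n))) 0 0 1%:M :> 'M_(2 + n).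
  rewrite -{1}[g](@submxK _ 2 n 2 n); congr block_mx.
  - apply/matrixP => i j; rewrite !mxE Ig /= ?leq_addr ?orbT // -val_eqE /=.
    by rewrite (_ : (_ == _) = false) //; apply/negbTE; have := ltn_ord i; lia.
  - apply/matrixP => i j; rewrite !mxE Ig /= ?leq_addr ?orbT // -val_eqE /=.
    by rewrite (_ : (_ == _) = false) //; apply/negbTE; have := ltn_ord j; lia.
  - apply/matrixP => i j; rewrite !mxE Ig /= ?leq_addr ?orbT // -!val_eqE /=.
transitivity (\det (block_mx (ulsubmx (g : 'M_(2 + n))) 0 0 1%:M : 'M_(2 + n))).
  by rewrite -gE.
rewrite det_ublock det1 mulr1.
rewrite (expand_det_row _ 0) !big_ord_recl big_ord0 /cofactor !det_mx11 !mxE /=.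
rewrite expr0 mul1r addr0 expr1 mulN1r mulrN.
by congr (_ * _ - _ * _); congr (g _ _); apply: val_inj.
Qed.

(** * Reduction to a block of size two *)

Section Stability.
Variables (R : comUnitRingType) (n' : nat) (q : R) (Q : nat).
Local Notation n := n'.+3.
Hypothesis int_surj : forall a : R, exists t : int, t%:~R = a.
Variable N : R -> nat.
Hypothesis euclid : forall a b : R, b != 0 -> exists c, (N (a - c * b) < N b)%N.
Hypothesis Q0 : (0 < Q)%N.
Hypothesis Qq : exists c, Q%:R = q * c.
Hypothesis qQ : forall (t : int) b, t%:~R = q * b -> (Q %| `|t|)%N.
Implicit Types g : 'M[R]_n.

Lemma normE_row i (s : 'rV[R]_n) : s 0 i = 0 -> normE q (1%:M + delta_mx i 0 *m (q *: s)).
Proof. by apply: closure_row; [exact: normE1|exact: normEM|move=> *; exact: normE_el]. Qed.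

Lemma normE_col j (u : 'cV[R]_n) : u j 0 = 0 -> normE q (1%:M + (q *: u) *m delta_mx 0 j).
Proof. by apply: closure_col; [exact: normE1|exact: normEM|move=> *; exact: normE_el]. Qed.

Lemma congE g i j : cong q g -> exists a, g i j = (i == j)%:R + q * a.
Proof. by case=> A ->; exists (A i j); rewrite !mxE. Qed.

Lemma stab_base g : idout 2 g -> \det g = 1 -> cong q g -> normE q g.
Proof.
move=> Ig g1 cg; have E : g = emb 0 1 (g 0 0, g 0 1, g 1 0, g 1 1) by apply: block2_emb.
rewrite E; apply: (normE_emb (isT : (2 < n)%N) int_surj euclid Q0 Qq qQ) => //.
- by rewrite -(det_idout2 Ig).
- by have [a ->] := congE 0 0 cg; exists a; rewrite eqxx addrC addKr.
- by have [a ->] := congE 0 1 cg; exists a; rewrite add0r.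
- by have [a ->] := congE 1 0 cg; exists a; rewrite add0r.
- by have [a ->] := congE 1 1 cg; exists a; rewrite eqxx addrC addKr.
Qed.

Section Step.
Variable m : 'I_n.
Hypothesis m2 : (2 <= m)%N.
Hypothesis IH : forall g, idout m g -> \det g = 1 -> cong q g -> normE q g.
Let m0 : m != 0. Proof. by apply/eqP => E; move: m2; rewrite E. Qed.
Let m1 : m != 1. Proof. by apply/eqP => E; move: m2; rewrite E. Qed.

Let m0' : 0 != m. Proof. by rewrite eq_sym. Qed.
Let m1' : 1 != m. Proof. by rewrite eq_sym. Qed.

Definition good g := [/\ idout m.+1 g, \det g = 1 & cong q g].

Lemma good_conj g (i j : 'I_n) t : (i <= m)%N -> (j <= m)%N -> i != j -> good g ->
  good (el i j t *m g *m el i j (- t)).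
Proof.
move=> im jm ij [Ig g1 cg]; split.
- by do !apply: idoutM => //; apply: idout_el.
- by rewrite !det_mulmx !det_el // g1 !mulr1.
- by rewrite -invmx_el //; apply: cong_conj; rewrite ?el_unit.
Qed.

(** Operations of arbitrary level are admissible as conjugations, though not as one-sided factors.
    By [col_conj], they act on column m as row operations. *)
Lemma normE_elconj g i j t : i != j -> normE q (el i j t *m g *m el i j (- t)) -> normE q g.
Proof. by move=> ij; rewrite -invmx_el //; apply: normE_conjV; rewrite det_el. Qed.

Lemma col_conj g i j t k : j != m -> (el i j t *m g *m el i j (- t)) k m = g k m + (k == i)%:R * t * g j m.
Proof. by move=> jm; rewrite mul_el el_mul (eq_sym m j) (negPf jm) mulr0 addr0. Qed.

Lemma step_clear g : good g -> g m m = 1 -> normE q g.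
Proof.
move=> [Ig g1 cg] gm.
have [A gE] := cg.
pose u : 'cV[R]_n := \col_i (if i == m then 0 else - A i m).
have uE i : (q *: u) i 0 = if i == m then 0 else - g i m.
  by rewrite !mxE; case: eqP => [|/eqP im]; rewrite ?mulr0 // gE !mxE (negPf im) add0r mulrN.
have Nu : normE q (1%:M + (q *: u) *m delta_mx 0 m) by apply: normE_col; rewrite mxE eqxx.
apply: (normE_cancell Nu); set g' := _ *m g.
have g'E i j : g' i j = g i j + (q *: u) i 0 * g m j.
  rewrite /g' mulmxDl mul1mx -mulmxA -rowE mxE; congr (_ + _).
  by rewrite mxE big_ord1 !mxE.
have g'm i : g' i m = (i == m)%:R.
  rewrite g'E uE gm mulr1; case: eqP => [->|_]; first by rewrite addr0 gm.
  by rewrite subrr.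
have cg' : cong q g' by apply: congM => //; apply: normE_cong.
have [B g'B] := cg'.
pose s : 'rV[R]_n := \row_j (if j == m then 0 else - B m j).
have sE j : (q *: s) 0 j = if j == m then 0 else - g' m j.
  rewrite mxE [s 0 j]mxE; case: eqP => [|/eqP jm]; rewrite ?mulr0 // g'B !mxE.
  by rewrite eq_sym (negPf jm) add0r mulrN.
have Ns : normE q (1%:M + delta_mx m 0 *m (q *: s)) by apply: normE_row; rewrite mxE eqxx.
apply: (normE_cancelr Ns); set g'' := g' *m _.
have g''E i j : g'' i j = g' i j + g' i m * (q *: s) 0 j.
  rewrite /g'' mulmxDr mulmx1 mulmxA -colE mxE; congr (_ + _).
  by rewrite mxE big_ord1 !mxE.
apply: IH.
- have Im (i j : 'I_n) : (m < i)%N || (m < j)%N -> g' i j = (i == j)%:R.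
    move=> ij; rewrite g'E uE; case: (ltnP m i) ij => [mi _|im /= mj].
      have -> : (i == m) = false by apply/negbTE; rewrite -val_eqE /=; lia.
      rewrite Ig ?mi // (Ig i m) ?mi //.
      have -> : (i == m) = false by apply/negbTE; rewrite -val_eqE /=; lia.
      by rewrite oppr0 mul0r addr0.
    rewrite Ig ?mj ?orbT // (Ig m j) ?mj ?orbT //.
    have -> : (m == j) = false by apply/negbTE; rewrite -val_eqE /=; lia.
    by rewrite mulr0 addr0.
  move=> i j ij; rewrite g''E g'm sE.
  have [jm|jm] := eqVneq j m; first by rewrite mulr0 addr0 jm g'm.
  have [im|im] := eqVneq i m.
    by rewrite im mul1r subrr eq_sym (negPf jm).
  rewrite mul0r addr0 Im //.
  by move: ij im jm; rewrite -!val_eqE /=; lia.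
- by rewrite !det_mulmx (normE_det Nu) (normE_det Ns) g1 !mulr1.
- by apply: congM => //; apply: normE_cong.
Qed.

Lemma step_zero g : good g -> g 0 m = 0 -> normE q g.
Proof.
move=> Gg g0; have [Ig g1 [A gE]] := Gg.
have Ug := det1_unit g1.
(* Row m of the inverse of g, paired with column m of g, gives 1; the omitted positions meet zeros
   of that column. The factor -q A_mm = 1 - g_mm therefore places 1 - g_mm at position (0, m). *)
pose s : 'rV[R]_n := \row_i (if (i == 0) || (m < i)%N then 0 else - A m m * invmx g m i).
have Ns : normE q (1%:M + delta_mx 0 0 *m (q *: s)) by apply: normE_row; rewrite mxE.
apply: (normE_cancell Ns); set g' := _ *m g.
have g'E i j : g' i j = g i j + (i == 0)%:R * ((q *: s) *m g) 0 j.
  rewrite /g' mulmxDl mul1mx -mulmxA mxE; congr (_ + _).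
  by rewrite mxE big_ord1 !mxE eqxx andbT.
have g'0 : g' 0 m = 1 - g' m m.
  rewrite !g'E g0 (negPf m0) mul0r addr0 add0r eqxx mul1r.
  have : (invmx g *m g) m m = 1 by rewrite mulVmx // mxE eqxx.
  rewrite mxE => E.
  transitivity (- (q * A m m) * \sum_j invmx g m j * g j m).
    rewrite mxE mulr_sumr; apply: eq_bigr => i _; rewrite !mxE.
    case: (eqVneq i 0) => [->|i0] /=; first by rewrite g0 !mulr0.
    case: (ltnP m i) => [mi|_]; last by ring.
    rewrite mulr0 mul0r (Ig i m) ?mi // (_ : (i == m) = false) ?mulr0 //.
    by apply/negbTE; rewrite -val_eqE /=; lia.
  by rewrite E mulr1 gE !mxE eqxx opprD addrA subrr add0r.
have Gg' : good g'.
  split.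
  - apply: idoutM Ig => i j ij; rewrite !mxE big_ord1 !mxE eqxx andbT.
    case: (eqVneq i 0) ij => [->|_] //=; last by rewrite mul0r addr0.
    by move=> mj; rewrite mj orbT !mulr0 addr0.
  - by rewrite det_mulmx (normE_det Ns) g1 mulr1.
  - by apply: congM; [exact: normE_cong | exists A].
(* This adds row 0 to row m in column m, so the corner entry becomes 1. *)
apply: (@normE_elconj _ m 0 1) => //; apply: step_clear; first exact: good_conj.
by rewrite col_conj // eqxx !mul1r g'0 addrC subrK.
Qed.

(** The Euclidean algorithm on the entries (0, m) and (1, m), run by conjugations, until the entry
    (0, m) vanishes. If (1, m) vanishes first, two conjugations move the other entry there. *)
Lemma stab_step g : good g -> normE q g.
Proof.
have n01 : (0 == 1 :> 'I_n) = false by [].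
have n10 : (1 == 0 :> 'I_n) = false by [].
have i1m : ((1%R : 'I_n) <= m)%N by apply: ltnW.
move: {2}(N (g 1%R m)).+1 (ltnSn (N (g 1%R m))) => k; elim: k g => // k IHk g gk Gg.
have [g1|g1] := eqVneq (g 1 m) 0.
  apply: (@normE_elconj _ 1 0 1) => //; apply: (@normE_elconj _ 0 1 (-1)) => //.
  apply: step_zero; first by do !apply: good_conj.
  by rewrite !col_conj // !eqxx n01 g1 mulr0n mulr1n; ring.
have [c Nc] := euclid (g 0 m) g1.
apply: (@normE_elconj _ 0 1 (- c)) => //; set g' := _ *m _.
have Gg' : good g' by apply: good_conj.
have g'0 : g' 0 m = g 0 m - c * g 1 m by rewrite col_conj // eqxx mulr1n; ring.
have g'1 : g' 1 m = g 1 m by rewrite col_conj // n10 !mul0r addr0.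
have [z|z] := eqVneq (g' 0 m) 0; first exact: step_zero.
have [d Nd] := euclid (g' 1 m) z.
apply: (@normE_elconj _ 1 0 (- d)) => //; apply: IHk; last by apply: good_conj.
rewrite col_conj // eqxx mul1r mulNr.
by apply: leq_trans Nd _; rewrite g'0; apply: leq_trans (ltnW Nc) _.
Qed.

End Step.

Theorem congruence_normE g : \det g = 1 -> cong q g -> normE q g.
Proof.
suff H m : (2 <= m <= n)%N -> forall g, idout m g -> \det g = 1 -> cong q g -> normE q g.
  move=> g1 cg; apply: (H n) => //.
    by rewrite leqnn.
  by move=> i j; rewrite (leqNgt n i) (leqNgt n j) !ltn_ord.
elim: m => // m IH /andP[m2 mn].
case: (ltnP m 2) => [m1|m1].
  have -> : m = 1%N by lia.
  by move=> {}g; apply: stab_base.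
move=> {}g Ig g1 cg; apply: (@stab_step (Ordinal mn)) => //.
by apply: IH; lia.
Qed.

End Stability.

Local Open Scope classical_set_scope.

(** * Descent along a subnormal series *)

Section Subnormal.
Variables (R : comUnitRingType) (n : nat).
Hypothesis n2 : (2 < n)%N.
Implicit Types (H K : set 'M[R]_n) (A B X : 'M[R]_n) (i j k p q : 'I_n) (a b c z : R).

Lemma subgroup_unit H A : is_subgroup H -> H A -> A \in unitmx.
Proof. by case=> HG _ _ _ /HG. Qed.

(** X is the commutator A (B A^-1 B^-1), a product of two elements of H by normality. Stated as a
    relation, it takes Steinberg-type identities as they are. *)
Lemma normal_commr H K A B X : is_normal_in H K -> H A -> K B ->
  A *m B = X *m B *m A -> H X.
Proof.
move=> [sH sK _ nHK] HA KB E.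
have UA := subgroup_unit sH HA; have UB := subgroup_unit sK KB.
have [_ _ HM HV] := sH; have [_ _ _ KV] := sK.
have -> : X = A *m (invmx (invmx B) *m invmx A *m invmx B).
  by rewrite invmxK !mulmxA E mulmxK // mulmxK.
by apply: HM => //; apply: nHK; [exact: KV | exact: HV].
Qed.

Lemma normal_comml H K A B X : is_normal_in H K -> H A -> K B ->
  B *m A = X *m A *m B -> H X.
Proof.
move=> [sH sK _ nHK] HA KB E.
have UA := subgroup_unit sH HA; have UB := subgroup_unit sK KB.
have [_ _ HM HV] := sH; have [_ _ _ KV] := sK.
have -> : X = (invmx (invmx B) *m A *m invmx B) *m invmx A.
  by rewrite invmxK E !mulmxK.
by apply: HM; [apply: nHK => //; exact: KV | exact: HV].
Qed.

Lemma mulmx_rank1 (u v : 'cV[R]_n) (s t : 'rV[R]_n) :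
  (u *m s) *m (v *m t) = (s *m v) 0 0 *: (u *m t).
Proof.
by rewrite mulmxA -(mulmxA u) [s *m v in LHS]mx11_scalar mul_mx_scalar -scalemxAl.
Qed.

Lemma rank1_swap A B X : A *m B = X -> B *m A = 0 -> X *m A = 0 -> X *m B = 0 ->
  (1%:M + A) *m (1%:M + B) = (1%:M + X) *m (1%:M + B) *m (1%:M + A).
Proof.
move=> AB BA XA XB.
rewrite -[RHS]mulmxA [(1%:M + B) *m (1%:M + A)]mulmxDl mul1mx [B *m _]mulmxDr mulmx1 BA addr0.
rewrite [RHS]mulmxDl mul1mx ![X *m _]mulmxDr mulmx1 XA XB !addr0.
rewrite mulmxDr mulmx1 mulmxDl mul1mx AB.
by rewrite !addrA.
Qed.

(* With u the column j of h and s orthogonal to u, conjugating 1 + a e_j (s h),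
   which is in K, by h gives 1 + a u s; so m = (1 + a u s) (1 - a e_j s h) is in
   H.  Commutators with el j i a and el k i (a b) then isolate one entry. *)
Lemma normal_offdiag H K a h i j : is_normal_in H K ->
  (forall p q b, p != q -> K (el p q (a * b))) -> H h -> i != j ->
  forall b, H (el j i (a ^+ 3 * h i j ^+ 2 * b)).
Proof.
move=> nHK Kel Hh ij b; have [k jk ik] := third_index n2 i j.
have [sH sK HK _] := nHK; have Uh := subgroup_unit sH Hh.
have [_ K1 KM _] := sK.
have ji : j != i by rewrite eq_sym.
have ki : k != i by rewrite eq_sym.
have kj : k != j by rewrite eq_sym.
pose u : 'cV[R]_n := col j h.
have uE p : u p 0 = h p j by rewrite mxE.
pose s : 'rV[R]_n := u i 0 *: delta_mx 0 k - u k 0 *: delta_mx 0 i.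
have sE p : s 0 p = u i 0 * (p == k)%:R - u k 0 * (p == i)%:R by rewrite !mxE.
have su : s *m u = 0.
  rewrite mulmxBl -!scalemxAl -!rowE; apply/matrixP => x y.
  by rewrite [y]ord1 !mxE; ring.
have sj : s 0 j = 0 by rewrite sE (negPf jk) (negPf ji) !mulr0 subrr.
have rdE (t : 'rV[R]_n) p : (t *m delta_mx p 0 : 'M_1) 0 0 = t 0 p by rewrite -colE mxE.
have drE (v : 'cV[R]_n) p : ((delta_mx 0 p : 'rV_n) *m v) 0 0 = v p 0 by rewrite -rowE mxE.
have dE p q c : c *: delta_mx p q = (delta_mx p 0 : 'cV_n) *m (c *: delta_mx 0 q : 'rV_n).
  by rewrite -scalemxAr mul_delta_mx.
have shj : (s *m h) 0 j = 0 by rewrite -rdE -mulmxA -colE -/u su mxE.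
pose r := a *: (s *m h).
have rj : r 0 j = 0 by rewrite mxE shj mulr0.
pose Y : 'M[R]_n := delta_mx j 0 *m r.
have YY : Y *m Y = 0 by rewrite mulmx_rank1 rdE rj scale0r.
have Ky : K (1%:M + Y).
  exact: (closure_row (S := K) (a := a)).
pose U : 'M[R]_n := u *m (a *: s).
pose m := (1%:M + U) *m (1%:M - Y).
have Hm : H m.
  apply: (normal_commr nHK Hh Ky).
  have -> : m *m (1%:M + Y) = 1%:M + U.
    rewrite -mulmxA (_ : (1%:M - Y) *m (1%:M + Y) = 1%:M) ?mulmx1 //.
    by rewrite mulmxDr mulmx1 mulmxBl mul1mx YY subr0 subrK.
  rewrite mulmxDr mulmx1 mulmxDl mul1mx; congr (_ + _).
  by rewrite /Y /U mulmxA -colE -/u -mulmxA -scalemxAl.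
pose Z : 'M[R]_n := (delta_mx j 0 : 'cV_n) *m (a *: delta_mx 0 i).
have ZE : el j i a = 1%:M + Z by rewrite /el dE.
have drZ (v : 'cV[R]_n) c p : ((c *: (delta_mx 0 p : 'rV_n)) *m v) 0 0 = c * v p 0.
  by rewrite -scalemxAl mxE drE.
have asd p : ((a *: s) *m delta_mx p 0 : 'M_1) 0 0 = a * s 0 p by rewrite rdE mxE.
pose P : 'M[R]_n := (a * u i 0) *: (delta_mx j 0 *m (a *: s)).
have ZU : Z *m U = P by rewrite mulmx_rank1 drZ.
have UZ : U *m Z = 0 by rewrite mulmx_rank1 asd sj mulr0 scale0r.
have PZ : P *m Z = 0 by rewrite -scalemxAl mulmx_rank1 asd sj mulr0 scale0r scaler0.
have asu : (a *: s) *m u = 0 by rewrite -scalemxAl su scaler0.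
have PU : P *m U = 0 by rewrite -scalemxAl mulmxA -(mulmxA _ (a *: s)) asu mulmx0 mul0mx scaler0.
have ZY : Z *m Y = 0 by rewrite mulmx_rank1 drZ mxE (negPf ij) mulr0 scale0r.
have YZ : Y *m Z = 0 by rewrite mulmx_rank1 rdE rj scale0r.
have HP : H (1%:M + P).
  apply: (normal_comml nHK Hm (Kel j i 1 ji)); rewrite mulr1 ZE /m.
  rewrite mulmxA (rank1_swap ZU UZ PZ PU) -!mulmxA; congr (_ *m (_ *m _)).
  rewrite [RHS]mulmxBl mul1mx [Y *m _]mulmxDr mulmx1 YZ addr0.
  by rewrite mulmxBr mulmx1 mulmxDl mul1mx ZY addr0.
pose V : 'M[R]_n := (delta_mx k 0 : 'cV_n) *m ((a * b) *: delta_mx 0 i).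
(* Each of u s, el j i a and el k i (a b) contributes one factor a; the two entries u_i and s_k met
   on the way both equal h_ij. *)
pose c := a ^+ 3 * h i j ^+ 2 * b.
have sk : s 0 k = h i j by rewrite sE eqxx (negPf ki) mulr1 mulr0 subr0 uE.
have PV : P *m V = c *: delta_mx j i.
  rewrite -scalemxAl mulmx_rank1 asd sk -scalemxAr mul_delta_mx !scalerA; congr (_ *: _).
  by rewrite /c uE; ring.
have VP : V *m P = 0 by rewrite -scalemxAr mulmx_rank1 drZ [delta_mx j 0 i 0]mxE (negPf ij) mulr0 scale0r scaler0.
have WP : (c *: delta_mx j i) *m P = 0.
  by rewrite dE -scalemxAr mulmx_rank1 drZ [delta_mx j 0 i 0]mxE (negPf ij) mulr0 scale0r scaler0.
have WV : (c *: delta_mx j i) *m V = 0.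
  by rewrite dE mulmx_rank1 drZ mxE (negPf ik) mulr0 scale0r.
apply: (normal_commr nHK HP (Kel k i b ki)).
have -> : el k i (a * b) = 1%:M + V by rewrite /el dE.
exact: rank1_swap PV VP WP WV.
Qed.

Lemma elRl i j k a b : i != j -> j != k -> i != k ->
  el i j a *m el j k b = el i k (a * b) *m el j k b *m el i j a :> 'M[R]_n.
Proof.
move=> ij jk ik; rewrite elR // -mulmxA elC // 1?eq_sym // mulmxA.
by rewrite elC // eq_sym.
Qed.

Section Spread.
Variables (H K : set 'M[R]_n) (a z : R).
Hypothesis nHK : is_normal_in H K.
Hypothesis Kel : forall p q b, p != q -> K (el p q (a * b)).

Definition elin p q t := forall b, H (el p q (a ^+ t * z * b)).

Lemma elin_le p q t t' : (t <= t')%N -> elin p q t -> elin p q t'.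
Proof.
move=> tt Ht b; have := Ht (a ^+ (t' - t) * b).
by rewrite (_ : a ^+ t * z * (a ^+ (t' - t) * b) = a ^+ t' * z * b) // -[in RHS](subnKC tt) exprD; ring.
Qed.

Lemma elin_col p q q' t : p != q -> p != q' -> q != q' -> elin p q t -> elin p q' t.+1.
Proof.
move=> pq pq' qq' Ht b; apply: (normal_commr nHK (Ht b) (Kel 1 qq')).
rewrite elRl //; congr (el _ _ _ *m _ *m _); rewrite exprS; ring.
Qed.

Lemma elin_row p p' q t : p != q -> p' != q -> p' != p -> elin p q t -> elin p' q t.+1.
Proof.
move=> pq pq' pp' Ht b; apply: (normal_comml nHK (Ht b) (Kel 1 pp')).
rewrite elRl //; congr (el _ _ _ *m _ *m _); rewrite exprS; ring.
Qed.

(** Each change of one index is a commutator with K and costs one factor a. The longest route is the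
    transposition (i, j), (i, k), (j, k), (j, i), whence 3. *)
Lemma elin_all i j p q t : i != j -> p != q -> elin i j t -> elin p q (t + 3).
Proof.
move=> ij pq Ht; have ji : j != i by rewrite eq_sym.
have [qi|qi] := eqVneq q i; last first.
  have H1 : elin i q t.+1.
    have [jq|jq] := eqVneq j q; first by subst q; apply: elin_le Ht; lia.
    by apply: elin_col Ht; rewrite // eq_sym.
  have [pi|pi] := eqVneq p i; first by subst p; apply: elin_le H1; lia.
  have H2 : elin p q t.+2 by apply: elin_row H1; rewrite // eq_sym.
  by apply: elin_le H2; lia.
subst q.
have [pj|pj] := eqVneq p j; last first.
  have H1 : elin p j t.+1 by apply: elin_row Ht.
  have H2 : elin p i t.+2 by apply: elin_col H1.
  by apply: elin_le H2; lia.
subst p; have [k jk ik] := third_index n2 i j.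
have H1 : elin i k t.+1 by apply: elin_col Ht.
have H2 : elin j k t.+2 by apply: elin_row H1.
have H3 : elin j i t.+3 by apply: elin_col H2; rewrite // eq_sym.
by apply: elin_le H3; lia.
Qed.

End Spread.

(* z is good for H. *)
Definition inT H z := exists k : nat, forall p q b, p != q -> H (el p q (z ^+ k * b)).

Section Radical.
Variable H : set 'M[R]_n.
Hypothesis sH : is_subgroup H.

Lemma inT0 : inT H 0.
Proof. by have [_ H1 _ _] := sH; exists 1%N => p q b pq; rewrite expr1 mul0r el0. Qed.

Lemma inTM c z : inT H z -> inT H (c * z).
Proof.
by move=> [k Hk]; exists k => p q b pq; rewrite exprMn mulrAC mulrC; apply: Hk.
Qed.

Lemma inTD z z' : inT H z -> inT H z' -> inT H (z + z').
Proof.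
have [_ _ HM _] := sH.
move=> [k Hk] [k' Hk']; exists (k + k')%N => p q b pq.
have [c [c' ->]] : exists c c', (z + z') ^+ (k + k') = z ^+ k * c + z' ^+ k' * c'.
  rewrite exprDn.
  apply: (big_ind (fun y => exists c c', y = z ^+ k * c + z' ^+ k' * c')).
  - by exists 0, 0; rewrite !mulr0 addr0.
  - move=> x y [c [c' ->]] [d [d' ->]]; exists (c + d), (c' + d'); ring.
  - move=> i _; case: (leqP k' i) => ki.
      exists 0, (z ^+ (k + k' - i) * z' ^+ (i - k') *+ 'C(k + k', i)).
      by rewrite mulr0 add0r mulrnAr mulrCA -exprD subnKC.
    exists (z ^+ (k' - i) * z' ^+ i *+ 'C(k + k', i)), 0.
    rewrite mulr0 addr0 mulrnAr mulrA -exprD; congr (_ ^+ _ * _ *+ _); lia.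
rewrite mulrDl -!mulrA elD //; apply: HM; [exact: Hk | exact: Hk'].
Qed.

Lemma inT_root m z : inT H (z ^+ m) -> inT H z.
Proof. by move=> [k Hk]; exists (m * k)%N => p q b pq; rewrite exprM; apply: Hk. Qed.

End Radical.

Lemma inT_off H K z h i j : is_normal_in H K -> inT K z -> H h -> i != j ->
  inT H (z * h i j).
Proof.
move=> nHK [k Kk] Hh ij; have ji : j != i by rewrite eq_sym.
have Kel p q b : p != q -> K (el p q (z ^+ k * b)) by move=> pq; apply: Kk.
have H0 : elin H (z ^+ k) (h i j ^+ 2) j i 3.
  by move=> b; apply: normal_offdiag nHK Kel Hh ij b.
(* [normal_offdiag] costs a^3 and [elin_all] another a^3, with a = z^k; this gives z^(6k) h_ij^2,
   which divides the power 6k + 2 of z h_ij. *)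
exists (6 * k + 2)%N => p q b pq.
have := elin_all nHK (fun p q b => @Kel p q b) ji pq H0 (h i j ^+ (6 * k) * z ^+ 2 * b).
congr (H (el p q _)); rewrite exprMn.
have -> : (6 * k + 2 = k + k + k + k + k + k + 2)%N by lia.
have -> : (6 * k = k + k + k + k + k + k)%N by lia.
rewrite !exprD; move: (z ^+ k) (h i j ^+ k) => u v; ring.
Qed.

Lemma inT_diag H K z h i j : is_normal_in H K -> inT K z -> H h ->
  inT H (z * (h i i - h j j)).
Proof.
move=> nHK Kz Hh; have [sH sK _ nK] := nHK.
have [->|ij] := eqVneq i j; first by rewrite subrr mulr0; apply: inT0.
have ji : j != i by rewrite eq_sym.
have [k Kk] := Kz.
pose a := z ^+ k.
(* The (i, j) entry of this conjugate is h_ij - a (h_ii - h_jj) - a^2 h_ji, so the diagonal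
   difference is read off from three off-diagonal entries. *)
have Ha : H (el i j a *m h *m el i j (- a)).
  have := nK (el i j (- a)) h; rewrite !invmx_el // opprK; apply=> //.
  by rewrite -[- a]mulr1 -mulN1r -mulrA mulrC -mulrA; apply: Kk.
have T1 := inT_off nHK Kz Ha ij.
have T2 := inT_off nHK Kz Hh ij.
have T3 := inT_off nHK Kz Hh ji.
have T : inT H (z ^+ k.+1 * (h i i - h j j)).
  have -> : z ^+ k.+1 * (h i i - h j j) =
     (-1) * (z * (el i j a *m h *m el i j (- a)) i j) + ((z * h i j) + (- a ^+ 2) * (z * h j i)).
    rewrite mul_el !el_mul !eqxx exprS -/a mulr1n. ring.
  by apply: inTD => //; [apply: inTM | apply: inTD => //; apply: inTM].
apply: (inT_root (m := k.+1)).
have := inTM ((h i i - h j j) ^+ k) T.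
by congr (inT H _); rewrite exprMn [in RHS](exprSr (h i i - h j j)); ring.
Qed.

Lemma smallest_ideal_sub (G I : set R) : is_ideal I -> G `<=` I -> smallest (@is_ideal R) G `<=` I.
Proof. by move=> iI GI; apply: smallest_sub. Qed.

Lemma level_inT (H0 H K : set 'M[R]_n) z : H0 `<=` H -> is_normal_in H K -> inT K z ->
  level H0 `<=` [set x | inT H (z * x)].
Proof.
move=> H0H nHK Kz; have [sH _ _ _] := nHK.
have id : is_ideal [set x | inT H (z * x)].
  split=> /=.
  - by rewrite mulr0; apply: inT0.
  - by move=> x y Hx Hy; rewrite mulrDr; apply: inTD.
  - by move=> c x Hx; rewrite mulrCA; apply: inTM.
apply: smallest_ideal_sub => // x [h Hh]; apply: smallest_ideal_sub => // {}x [] /=.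
  by case=> [i [j [ij ->]]]; apply: (inT_off nHK Kz) => //; apply: H0H.
by case=> [i [j ->]]; have := inT_diag i j nHK Kz (H0H _ Hh).
Qed.

Lemma subnormal_inT (H : set 'M[R]_n) l : is_subnormal H -> level H l -> inT H l.
Proof.
move=> [d [S [S0 Sd Sn]]] Hl.
have HS (t : nat) : (t <= d)%N -> H `<=` S t.
  elim: t => [|t IH] id; first by rewrite S0.
  by have [_ _ SS _] := Sn t id; exact: subset_trans (IH (ltnW id)) SS.
have main t : (t <= d)%N -> inT (S (d - t)%N) l.
  elim: t => [|t IH] td.
    by rewrite subn0 Sd; exists 0%N => p q b pq; exact: el_unit.
  have td' : (d - t.+1 < d)%N by lia.
  have nS := Sn _ td'; rewrite -subSn // subSS in nS.
  (* One normal step makes only l times the level good, hence l^2; the radical property recovers l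
     at once, so nothing is lost along the series. *)
  apply: (inT_root (m := 2)); rewrite expr2.
  exact: (level_inT (HS _ (ltnW td')) nS (IH (ltnW td)) Hl).
by have := main d (leqnn d); rewrite subnn S0.
Qed.

End Subnormal.

(** * Main theorem *)

Section Arithmetic.
Variable R : comUnitRingType.
Hypothesis ZR : Z_or_Zm R.

Lemma Z_or_Zm_surj (a : R) : exists t : int, t%:~R = a.
Proof.
case: ZR a => [a|m m1 a]; first by exists a; rewrite intz.
by exists (a : nat); rewrite -pmulrn natr_Zp.
Qed.

Lemma Z_or_Zm_euclid :
  exists N : R -> nat, forall a b : R, b != 0 -> exists c, (N (a - c * b)%R < N b)%N.
Proof.
case: ZR => [|m m1].
  exists absz => a b b0; exists (a %/ b)%Z.
  rewrite (_ : a - (a %/ b)%Z * b = (a %% b)%Z) //.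
  rewrite -ltz_nat abszE ger0_norm ?modz_ge0 // abszE. by rewrite ltz_mod.
exists (fun a : 'Z_m => a : nat) => a b b0; exists ((a %/ b)%N%:R).
have b_gt0 : (0 < b)%N by rewrite lt0n.
have -> : a - (a %/ b)%:R * b = (a %% b)%:R.
  have : a = ((a %/ b * b + a %% b)%N)%:R by rewrite -divn_eq natr_Zp.
  by rewrite natrD natrM natr_Zp => {1}->; rewrite addrC addKr.
rewrite val_Zp_nat //; apply: leq_ltn_trans (leq_mod _ _) _; exact: ltn_pmod.
Qed.

(* Q generates the preimage of the ideal l^k R in the integers. *)
Lemma Z_or_Zm_level (l : R) k : l != 0 ->
  exists Q : nat, [/\ (0 < Q)%N, exists c, Q%:R = l ^+ k * c
    & forall (t : int) b, t%:~R = l ^+ k * b -> (Q %| `|t|)%N].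
Proof.
case: ZR l => [l l0|m m1 l _].
  exists `|(l ^+ k)%R|%N; split.
  - by rewrite absz_gt0 expf_neq0.
  - exists (Num.sg (l ^+ k)); by rewrite natz abszE normrEsg mulrC.
  - by move=> t b; rewrite intz => ->; rewrite abszM dvdn_mulr.
move: (l ^+ k) => q; pose Q := gcdn q m; exists Q; split.
- by rewrite gcdn_gt0 (ltnW m1) orbT.
- have [u [v]] := Bezoutz (q : nat) m.
  move=> /(congr1 (intr : int -> 'Z_m)); rewrite rmorphD !rmorphM /= -!pmulrn pchar_Zp // mulr0 addr0 natr_Zp.
  by move=> E; exists u%:~R; rewrite mulrC E.
- move=> t b E.
  have : (m %| `|t - (q * b)%N%:Z|)%N.
    by rewrite -intr_Zp_eq0 // rmorphB /= -pmulrn natrM !natr_Zp E subrr.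
  move/(dvdn_trans (dvdn_gcdr q m)); rewrite -/Q => D.
  have /dvdnP[y yE] : (Q %| q * b)%N by rewrite dvdn_mulr // dvdn_gcdl.
  have /dvdzP[x xE] : (Q%:Z %| t - (q * b)%N%:Z)%Z by [].
  by rewrite -[t](subrK (q * b)%N%:Z) xE yE PoszM -mulrDl abszM dvdn_mull.
Qed.

End Arithmetic.

(** * Congruences and commutators *)

Section Congruence.
Variables (R : comUnitRingType) (n : nat).
Implicit Types (l q : R) (A B : 'M[R]_n) (H : set 'M[R]_n).

Lemma principal_ideal q : is_ideal (principal q).
Proof.
split=> [|x y [a ->] [b ->]|a x [b ->]] /=.
- by exists 0; rewrite mul0r.
- by exists (a + b); rewrite mulrDl.
- by exists (a * b); rewrite mulrA.
Qed.

Lemma mx_principal q A : (forall i j, principal q (A i j)) -> exists B, A = q *: B.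
Proof.
move=> qA; have qA' (x : 'I_n * 'I_n) : exists a, A x.1 x.2 = a * q by case: (qA x.1 x.2) => a aE; exists a.
have [f fE] := choice qA'.
exists (\matrix_(i, j) f (i, j)); apply/matrixP => i j.
by rewrite !mxE mulrC -(fE (i, j)).
Qed.

Lemma pcsP q A : pcs (principal q) A <-> \det A = 1 /\ cong q A.
Proof.
split=> [[A1 qA]|[A1 [B E]]].
  split=> //; have [|B E] := @mx_principal q (A - 1%:M).
    by move=> i j; have := qA i j; rewrite !mxE.
  by exists B; rewrite -E addrC subrK.
by split=> // i j; exists (B i j); rewrite E !mxE mulrC [LHS]addrC addKr.
Qed.

Lemma level_scalar H l A : level H = principal l -> H A ->
  exists b B, A = b%:M + l *: B.
Proof.
move=> Hl HA.
have lev x : mx_level A x -> principal l x.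
  by rewrite -Hl => Ax; apply: sub_gen_smallest; exists A.
have [n0|n0] := posnP n.
  by exists 0, 0; apply/matrixP => i j; exfalso; move: (ltn_ord i) n0; lia.
pose i0 := Ordinal n0.
have [|B E] := @mx_principal l (A - (A i0 i0)%:M).
  move=> i j; rewrite !mxE; have [->|ij] := eqVneq i j; last first.
    rewrite subr0; apply: lev; apply: sub_gen_smallest; left; by exists i, j.
  apply: lev; apply: sub_gen_smallest; right; by exists j, i0.
by exists (A i0 i0), B; rewrite -E addrC subrK.
Qed.

Lemma cong_inv q A : \det A = 1 -> cong q A -> cong q (invmx A).
Proof.
move=> A1 [B E]; exists (- (invmx A *m B)); have U := det1_unit A1.
rewrite scalerN scalemxAr (_ : q *: B = A - 1%:M) ?mulmxBr ?mulVmx ?mulmx1 ?opprB //.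
  by rewrite addrC subrK.
by rewrite E addrC addKr.
Qed.

Lemma cong_scale q c A : cong (q * c) A -> cong q A.
Proof. by move=> [B ->]; exists (c *: B); rewrite scalerA. Qed.

(** The commutator minus 1 is h^-1 g^-1 (h g - g h). In h g - g h the scalar part of h and the
    identity part of g drop out, leaving l times l^k. *)
Lemma cong_commutator l k h g : h \in unitmx -> g \in unitmx ->
   (exists b B, h = b%:M + l *: B) -> cong (l ^+ k) g ->
   cong (l ^+ k.+1) (invmx h *m invmx g *m h *m g).
Proof.
move=> Uh Ug [b [Y hE]] [X gE].
exists (invmx h *m invmx g *m (Y *m X - X *m Y)).
rewrite scalemxAr.
have <- : h *m g - g *m h = l ^+ k.+1 *: (Y *m X - X *m Y).
  rewrite hE gE [in LHS](mulmxDr _ 1%:M) [in LHS](mulmxDl 1%:M) mulmx1 mul1mx opprD addrACA subrr add0r.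
  rewrite mulmxDl mulmxDr -!scalemxAl -!scalemxAr scalar_mxC scalerDr opprD addrACA subrr add0r.
  by rewrite !scalerA scalerN exprSr [l * _]mulrC.
rewrite mulmxBr addrC -!mulmxA [invmx g *m (g *m h)]mulmxA mulVmx // mul1mx.
by rewrite mulVmx // subrK.
Qed.

End Congruence.

(** * The series above H *)

Section Series.
Variables (R : comUnitRingType) (n : nat) (H : set 'M[R]_n) (l : R).
Hypotheses (sH : is_subgroup H) (Hl : level H = principal l).
Implicit Types (A B g h : 'M[R]_n) (k : nat).

Definition sl_cong k : set 'M[R]_n := pcs (principal (l ^+ k)).

Lemma sl_congM k A B : sl_cong k A -> sl_cong k B -> sl_cong k (A *m B).
Proof.
move=> /pcsP[A1 cA] /pcsP[B1 cB]; apply/pcsP.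
by rewrite det_mulmx A1 B1 mulr1; split=> //; apply: congM.
Qed.

Lemma sl_congV k A : sl_cong k A -> sl_cong k (invmx A).
Proof.
move=> /pcsP[A1 cA]; apply/pcsP; split; last exact: cong_inv.
by rewrite det_inv A1 invr1.
Qed.

Lemma sl_cong_unit k A : sl_cong k A -> A \in unitmx.
Proof. by case=> A1 _; apply: det1_unit. Qed.

Lemma sl_congJ k A g : g \in unitmx -> sl_cong k A -> sl_cong k (invmx g *m A *m g).
Proof.
move=> Ug /pcsP[A1 cA]; apply/pcsP; split.
  by rewrite !det_mulmx A1 mulr1 -det_mulmx mulVmx // det1.
by rewrite -{2}[g]invmxK; apply: cong_conj; rewrite ?unitmx_inv.
Qed.

Lemma sl_cong1 k : sl_cong k 1%:M.
Proof. by apply/pcsP; rewrite det1; split=> //; exists 0; rewrite scaler0 addr0. Qed.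

Definition mul_cong k : set 'M[R]_n :=
  [set g | exists h c, [/\ H h, sl_cong k c & g = h *m c]].

Lemma H_unit h : H h -> h \in unitmx.
Proof. by case: sH => HG _ _ _ /HG. Qed.

Lemma mul_congH k h : H h -> mul_cong k h.
Proof. by move=> Hh; exists h, 1%:M; split=> //; [apply: sl_cong1 | rewrite mulmx1]. Qed.

Lemma mul_cong_sl k c : sl_cong k c -> mul_cong k c.
Proof.
by move=> Hc; exists 1%:M, c; split=> //; [case: sH | rewrite mul1mx].
Qed.

Lemma mul_cong_subgroup k : is_subgroup (mul_cong k).
Proof.
have [HG H1 HM HV] := sH; split.
- by move=> _ [h [c [Hh Hc ->]]]; rewrite /GL /= unitmx_mul H_unit // (sl_cong_unit Hc).
- exact: mul_congH.
- move=> _ _ [h [c [Hh Hc ->]]] [h' [c' [Hh' Hc' ->]]].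
  exists (h *m h'), ((invmx h' *m c *m h') *m c'); split.
  + exact: HM.
  + by apply: sl_congM => //; apply: sl_congJ => //; apply: H_unit.
  + by rewrite !mulmxA mulmxK // H_unit.
- move=> _ [h [c [Hh Hc ->]]].
  have Uh := H_unit Hh; have Uc := sl_cong_unit Hc.
  exists (invmx h), (h *m invmx c *m invmx h); split; first exact: HV.
    rewrite -{1}[h]invmxK; apply: sl_congJ; rewrite ?unitmx_inv //; exact: sl_congV.
  by rewrite invmxM // !mulmxA mulVmx // mul1mx.
Qed.

Lemma commutator_eq h g : h \in unitmx -> g \in unitmx ->
  invmx g *m h *m g = h *m (invmx h *m invmx g *m h *m g).
Proof. by move=> Uh Ug; rewrite !mulmxA mulmxV // mul1mx. Qed.

Lemma commutator_det h g : h \in unitmx -> g \in unitmx ->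
  \det (invmx h *m invmx g *m h *m g) = 1.
Proof.
move=> Uh Ug; rewrite !det_mulmx -mulrA mulrACA -!det_mulmx.
by rewrite mulVmx // mulVmx // mulmx1 det1.
Qed.

(** Conjugation by c in the congruence subgroup sends y in H to y [y, c], and the commutator lies
    one level deeper by [cong_commutator]; conjugation by elements of H is internal. *)
Lemma mul_cong_normal k : is_normal_in (mul_cong k.+1) (mul_cong k).
Proof.
split; [exact: mul_cong_subgroup | exact: mul_cong_subgroup | |].
  move=> _ [h [c [Hh /pcsP[c1 cc] ->]]]; exists h, c; split=> //.
  by apply/pcsP; split=> //; move: cc; rewrite exprSr; apply: cong_scale.
have [_ _ NM NV] := mul_cong_subgroup k.+1.
move=> _ _ [h [c [Hh Hc ->]]] [h' [c' [Hh' Hc' ->]]].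
have Uh := H_unit Hh; have Uc := sl_cong_unit Hc.
have Nc x : mul_cong k.+1 x -> mul_cong k.+1 (invmx c *m x *m c).
  move=> [y [d [Hy Hd ->]]]; have Uy := H_unit Hy.
  rewrite (_ : _ *m _ *m c = (invmx c *m y *m c) *m (invmx c *m d *m c)); last first.
    by rewrite !mulmxA mulmxK.
  apply: (NM); last by apply: mul_cong_sl; apply: sl_congJ.
  rewrite commutator_eq //; apply: (NM); first exact: mul_congH.
  apply: mul_cong_sl; apply/pcsP; split; first exact: commutator_det.
  apply: cong_commutator => //; first exact: (level_scalar Hl).
  by case/pcsP: Hc.
rewrite invmxM // (_ : _ *m _ *m _ = invmx c *m (invmx h *m (h' *m c') *m h) *m c).
  apply: Nc; apply: (NM); last exact: mul_congH.
  apply: (NM); first by apply: NV; apply: mul_congH.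
  by exists h', c'.
by rewrite !mulmxA.
Qed.

Lemma GL_subgroup : is_subgroup (@GL R n).
Proof.
split=> // [|g h Ug Uh|g Ug]; rewrite /GL /=.
- exact: unitmx1.
- by rewrite unitmx_mul; apply/andP.
- by rewrite unitmx_inv.
Qed.

(** At exponent 0 the congruence subgroup is all of SL, which contains every commutator of GL. *)
Lemma mul_cong_GL : is_normal_in (mul_cong 0) (@GL R n).
Proof.
have [NG _ NM _] := mul_cong_subgroup 0.
split=> //; [exact: mul_cong_subgroup | exact: GL_subgroup |].
move=> g x Ug Nx; have Ux := NG _ Nx; rewrite commutator_eq //; apply: NM => //.
apply: mul_cong_sl; apply/pcsP; split; first exact: commutator_det.
by exists (invmx x *m invmx g *m x *m g - 1%:M); rewrite scale1r addrC subrK.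
Qed.

Lemma cong_series r e : pcs (principal r) `<=` H -> divides r (l ^+ e) ->
  subnormal_series H e.+1.
Proof.
move=> rH rl; exists (fun j => if (j <= e)%N then mul_cong (e - j)%N else @GL R n).
split=> [||j je].
- rewrite subn0; apply/seteqP; split; last exact: mul_congH.
  have [_ _ HM _] := sH; move=> _ [h [c [Hh [c1 Hc] ->]]]; apply: HM => //.
  by apply: rH; split=> // i j; apply: rl.
- by rewrite ltnn.
- rewrite -ltnS je; case: ltnP => [je'|ej].
    by rewrite -[(e - j)%N]subSS subSn //; apply: mul_cong_normal.
  have -> : (e - j = 0)%N by lia.
  exact: mul_cong_GL.
Qed.

End Series.

Lemma normE_sub_gen (R : comUnitRingType) n (H : set 'M[R]_n) q A : is_subgroup H ->
  (forall s i j b, \det s = 1 -> i != j -> H (s *m el i j (q * b) *m invmx s)) ->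
  normE q A -> H A.
Proof. by move=> [_ H1 HM _] Hg; elim=> // B C _ HB _ HC; apply: HM. Qed.

Theorem pcs_of_subnormal (n : nat) (R : comUnitRingType) (H : set 'M[R]_n) (l : R) :
  (3 <= n)%N -> Z_or_Zm R -> is_subgroup H -> level H l -> l != 0 -> is_subnormal H ->
  exists k, pcs (principal (l ^+ k)) `<=` H.
Proof.
move=> n3 ZR sH Hl l0 /(subnormal_inT n3)/(_ Hl)[k Hk].
exists (k + k)%N => A /pcsP[A1 cA].
have [Q [Q0 Qq qQ]] := Z_or_Zm_level ZR (k + k) l0.
have [N euclid] := Z_or_Zm_euclid ZR.
have [_ H1 HM _] := sH.
apply: (@normE_sub_gen _ _ _ (l ^+ (k + k))) => //.
  move=> s i j b s1 ij; rewrite exprD.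
  by apply: (closure_conj (S := H)) => //; apply: det1_unit.
case: n n3 H sH Hl Hk H1 HM A A1 cA => [|[|[|n]]] // _ H _ _ _ _ _ A A1 cA.
exact: (congruence_normE (Z_or_Zm_surj ZR) euclid Q0 Qq qQ).
Qed.

Lemma least_exists (P : nat -> Prop) k : P k -> exists2 j, is_least P j & (j <= k)%N.
Proof.
move=> Pk; have ex : exists j, `[< P j >] by exists k; apply/asboolP.
case: (ex_minnP ex) => j /asboolP Pj jmin; exists j; last by apply/jmin/asboolP.
by split=> // i Pi; apply/jmin/asboolP.
Qed.

Theorem theorem1p24 (n : nat) (R : comUnitRingType) (H : set 'M[R]_n) (l r : R) :
  (3 <= n)%N ->
  Z_or_Zm R ->
  is_subgroup H ->
  level H = principal l ->
  l != 0 ->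
  is_max_pcs H (pcs (principal r)) ->
  (is_subnormal H <-> exists e : nat, divides r (l ^+ e)) /\
  (forall e' : nat, is_least (fun e => divides r (l ^+ e)) e' ->
     exists2 d : nat, is_defect H d & (d <= e'.+1)%N).
Proof.
move=> n3 ZR sH Hl l0 [_ rH rmax]; split; last first.
  by move=> e [re _]; apply: least_exists; apply: cong_series re.
split=> [sub|[e re]]; last by exists e.+1; apply: cong_series re.
have Hll : level H l by rewrite Hl; exists 1; rewrite mul1r.
have [k kH] := pcs_of_subnormal n3 ZR sH Hll l0 sub; exists k.
pose i0 : 'I_n := Ordinal (ltnW (ltnW n3)); pose i1 : 'I_n := Ordinal (ltnW n3).
(* By maximality the congruence subgroup of level l^k lies in the one of level r. One off-diagonal
   entry of this elementary matrix then shows that l^k is a multiple of r. *)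
have : pcs (principal r) (el i0 i1 (l ^+ k)).
  apply: (rmax (pcs (principal (l ^+ k)))) => //.
    by exists (principal (l ^+ k)) => //; apply: principal_ideal.
  by apply/pcsP; rewrite det_el //; split=> //; exists (delta_mx i0 i1).
move=> [_ /(_ i0 i1)]; rewrite elE !mxE /= mulr0n add0r subr0 mulr1n mul1r mulr1.
by move=> [c lE] _ [a ->]; exists (a * c); rewrite -mulrA -lE.
Qed.
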